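(* Let $\Omega=\mathbb{R}^2\setminus\{(r,1)\mid r\neq 0\}$ and $$\Omega'=\Omega\setminus\big(\{(r,s)\mid s=0\}\cup\{(0,1),(0,-1),(-1,2),(\tfrac13,-2)\}\big).$$ Let $(M^n,g)$ be a Hermitian manifold such that the canonical connection $D^r_{s}$ is Kähler-like for some $(r,s)\in\Omega'$. Then $g$ is Kähler.
   Context: Let $(M^n,g)$ be a Hermitian manifold with complex structure $J$ and Riemannian (Levi-Civita) connection $\nabla$. The Chern connection $\nabla^c$ is the unique connection $D$ with $Dg=0$, $DJ=0$ whose torsion has no $(1,1)$-component. The Strominger (Bismut) connection $\nabla^s$ is the unique connection $D$ with $Dg=0$, $DJ=0$ whose torsion is totally skew-symmetric (i.e. $g(T^D(x,y),z)$ is a $3$-form). For $r\in\mathbb{R}$ the Gauduchon connection is $D^{r}=\frac{1+r}{2}\nabla^c+\frac{1-r}{2}\nabla^s$, and the canonical $(r,s)$-connection is $D^r_s=(1-s)D^r+s\nabla$. A connection $D$ with $Dg=0$ (not necessarily $DJ=0$) is called Kähler-like if its curvature tensor $R^D(x,y,z,w)=g(R^D(x,y)z,w)$ satisfies, for all real tangent vectors $x,y,z,w$: $R^D(x,y,z,w)+R^D(y,z,x,w)+R^D(z,x,y,w)=0$ and $R^D(Jx,Jy,z,w)=R^D(x,y,z,w)=R^D(x,y,Jz,Jw)$. *)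

(* Defs.v *)
From HB Require Import structures.
From mathcomp Require Import all_boot all_order all_algebra.
From mathcomp Require Import sesquilinear.
From mathcomp Require Import all_classical all_reals all_analysis.

Set Implicit Arguments.
Unset Strict Implicit.
Unset Printing Implicit Defensive.

Import Order.TTheory GRing.Theory Num.Theory.
Import numFieldNormedType.Exports.

Local Open Scope classical_set_scope.
Local Open Scope ring_scope.

(* [U] is meant to be open.  In finite dimension, requiring differentiability
   and then the same of every directional derivative, indefinitely, is C^oo. *)
Fixpoint Ck_on (R : realType) (V W : normedModType R) (k : nat) (U : set V)
    (f : V -> W) : Prop :=
  match k with
  | 0 => forall x, U x -> {for x, continuous f}
  | k'.+1 => (forall x, U x -> differentiable f x) /\
             (forall v, Ck_on k' U (fun x => 'D_v f x))
  end.

Definition smooth_on (R : realType) (V W : normedModType R) (U : set V)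
    (f : V -> W) : Prop := forall k, Ck_on k U f.

(* C^n as a real vector space: the row [row_mx a b] stands for a + i b. *)
Notation Cvec R n := 'rV[R]_(n + n).

(* Multiplication by i. *)
Definition J (R : realType) (n : nat) (v : Cvec R n) : Cvec R n :=
  row_mx (- rsubmx v) (lsubmx v).

(* Cauchy-Riemann: the real differential commutes with i. *)
Definition holomorphic_on (R : realType) (n : nat) (U : set (Cvec R n))
    (f : Cvec R n -> Cvec R n) : Prop :=
  smooth_on U f /\
  forall x, U x -> forall v, 'D_(J v) f x = J ('D_v f x).

(* A complex structure on [M], given by an atlas of holomorphic charts; [param]
   is the inverse of the chart.  In these charts the almost complex structure of
   the tangent bundle is the constant operator [J]. *)
Record complexManifold (R : realType) (n : nat) (M : topologicalType) :=
  ComplexManifold {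
    chart : Type;
    dom : chart -> set M;
    coord : chart -> M -> Cvec R n;
    param : chart -> Cvec R n -> M;
    manifold_hausdorff : hausdorff_space M;
    manifold_second_countable : @second_countable M;
    dom_cover : forall p, exists c, dom c p;
    dom_open : forall c, open (dom c);
    img_open : forall c, open (coord c @` dom c);
    coordK : forall c p, dom c p -> param c (coord c p) = p;
    coord_continuous_on : forall c, {within dom c, continuous (coord c)};
    param_continuous_on :
      forall c, {within coord c @` dom c, continuous (param c)};
    transition_holomorphic : forall c d,
      holomorphic_on (coord c @` (dom c `&` dom d)) (coord d \o param c)
  }.

Definition img (R : realType) (n : nat) (M : topologicalType)
    (A : complexManifold R n M) (c : chart A) : set (Cvec R n) :=
  coord c @` dom c.

Definition overlap (R : realType) (n : nat) (M : topologicalType)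
    (A : complexManifold R n M) (c d : chart A) : set (Cvec R n) :=
  coord c @` (dom c `&` dom d).

Definition transition (R : realType) (n : nat) (M : topologicalType)
    (A : complexManifold R n M) (c d : chart A) : Cvec R n -> Cvec R n :=
  coord d \o param c.

(* Vector fields on a chart domain, read in that chart.  Identities between
   tensors are stated chart by chart for such local fields. *)
Definition vfield (R : realType) (n : nat) (M : topologicalType)
    (A : complexManifold R n M) (c : chart A) (X : Cvec R n -> Cvec R n) : Prop :=
  smooth_on (img c) X.

Record hermitianMetric (R : realType) (n : nat) (M : topologicalType)
    (A : complexManifold R n M) := HermitianMetric {
  metric : forall c : chart A,
    Cvec R n -> {bilinear Cvec R n -> Cvec R n -> R^o};
  metric_smooth : forall c u v,
    smooth_on (img c) (fun x => metric c x u v : R^o);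
  metric_sym : forall c x, img c x -> forall u v,
    metric c x u v = metric c x v u;
  metric_pos : forall c x, img c x -> forall u, u != 0 ->
    (0 : R) < metric c x u u;
  metric_J : forall c x, img c x -> forall u v,
    metric c x (J u) (J v) = metric c x u v;
  metric_transition : forall c d x, overlap c d x -> forall u v,
    metric d (transition c d x)
      ('D_u (transition c d) x) ('D_v (transition c d) x) = metric c x u v
}.

(* An affine connection on the (real) tangent bundle: Christoffel symbols in
   each chart, obeying the classical change-of-chart law. *)
Record connection (R : realType) (n : nat) (M : topologicalType)
    (A : complexManifold R n M) := Connection {
  christoffel : forall c : chart A,
    Cvec R n -> {bilinear Cvec R n -> Cvec R n -> Cvec R n};
  christoffel_smooth : forall c u v,
    smooth_on (img c) (fun x => christoffel c x u v);
  christoffel_transition : forall c d x, overlap c d x -> forall u v,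
    christoffel d (transition c d x)
      ('D_u (transition c d) x) ('D_v (transition c d) x) =
    'D_(christoffel c x u v) (transition c d) x
      - 'D_u (fun y => 'D_v (transition c d) y) x
}.

(* Operators (X, Y) |-> D_X Y on local vector fields, one in each chart. *)
Definition covDerivative (R : realType) (n : nat) (M : topologicalType)
    (A : complexManifold R n M) :=
  forall c : chart A,
    (Cvec R n -> Cvec R n) -> (Cvec R n -> Cvec R n) -> Cvec R n -> Cvec R n.

Definition cov (R : realType) (n : nat) (M : topologicalType)
    (A : complexManifold R n M) (D : connection A) : covDerivative A :=
  fun c X Y x => 'D_(X x) Y x + christoffel D c x (X x) (Y x).

Definition lie (R : realType) (n : nat) (X Y : Cvec R n -> Cvec R n) :
    Cvec R n -> Cvec R n :=
  fun x => 'D_(X x) Y x - 'D_(Y x) X x.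

Definition inner (R : realType) (n : nat) (M : topologicalType)
    (A : complexManifold R n M) (g : hermitianMetric A) (c : chart A)
    (X Y : Cvec R n -> Cvec R n) : Cvec R n -> R^o :=
  fun x => metric g c x (X x) (Y x).

Definition torsion (R : realType) (n : nat) (M : topologicalType)
    (A : complexManifold R n M) (D : covDerivative A) (c : chart A)
    (X Y : Cvec R n -> Cvec R n) : Cvec R n -> Cvec R n :=
  fun x => D c X Y x - D c Y X x - lie X Y x.

Definition curvature (R : realType) (n : nat) (M : topologicalType)
    (A : complexManifold R n M) (D : covDerivative A) (c : chart A)
    (X Y Z : Cvec R n -> Cvec R n) : Cvec R n -> Cvec R n :=
  fun x => D c X (D c Y Z) x - D c Y (D c X Z) x - D c (lie X Y) Z x.

Definition curvature4 (R : realType) (n : nat) (M : topologicalType)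
    (A : complexManifold R n M) (g : hermitianMetric A) (D : covDerivative A)
    (c : chart A) (X Y Z W : Cvec R n -> Cvec R n) : Cvec R n -> R^o :=
  inner g c (curvature D c X Y Z) W.

(* D g = 0 *)
Definition metric_parallel (R : realType) (n : nat) (M : topologicalType)
    (A : complexManifold R n M) (g : hermitianMetric A)
    (D : covDerivative A) : Prop :=
  forall (c : chart A) X Y Z, vfield c X -> vfield c Y -> vfield c Z ->
  forall x, img c x ->
    'D_(X x) (inner g c Y Z) x =
    inner g c (D c X Y) Z x + inner g c Y (D c X Z) x.

(* D J = 0 *)
Definition J_parallel (R : realType) (n : nat) (M : topologicalType)
    (A : complexManifold R n M) (D : covDerivative A) : Prop :=
  forall (c : chart A) X Y, vfield c X -> vfield c Y ->
  forall x, img c x -> D c X (@J R n \o Y) x = J (D c X Y x).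

Definition torsion_free (R : realType) (n : nat) (M : topologicalType)
    (A : complexManifold R n M) (D : covDerivative A) : Prop :=
  forall (c : chart A) X Y, vfield c X -> vfield c Y ->
  forall x, img c x -> torsion D c X Y x = 0.

(* The complexified torsion vanishes on (X - i J X, Y + i J Y): these are the
   real and imaginary parts of its value. *)
Definition torsion_no11 (R : realType) (n : nat) (M : topologicalType)
    (A : complexManifold R n M) (D : covDerivative A) : Prop :=
  forall (c : chart A) X Y, vfield c X -> vfield c Y ->
  forall x, img c x ->
    torsion D c X Y x + torsion D c (@J R n \o X) (@J R n \o Y) x = 0 /\
    torsion D c X (@J R n \o Y) x - torsion D c (@J R n \o X) Y x = 0.

Definition torsion_skew (R : realType) (n : nat) (M : topologicalType)
    (A : complexManifold R n M) (g : hermitianMetric A)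
    (D : covDerivative A) : Prop :=
  forall (c : chart A) X Y Z, vfield c X -> vfield c Y -> vfield c Z ->
  forall x, img c x ->
    inner g c (torsion D c Y X) Z x = - inner g c (torsion D c X Y) Z x /\
    inner g c (torsion D c X Z) Y x = - inner g c (torsion D c X Y) Z x.

Definition is_levi_civita (R : realType) (n : nat) (M : topologicalType)
    (A : complexManifold R n M) (g : hermitianMetric A)
    (D : connection A) : Prop :=
  metric_parallel g (cov D) /\ torsion_free (cov D).

Definition is_chern (R : realType) (n : nat) (M : topologicalType)
    (A : complexManifold R n M) (g : hermitianMetric A)
    (D : connection A) : Prop :=
  [/\ metric_parallel g (cov D), J_parallel (cov D) & torsion_no11 (cov D)].

Definition is_strominger (R : realType) (n : nat) (M : topologicalType)
    (A : complexManifold R n M) (g : hermitianMetric A)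
    (D : connection A) : Prop :=
  [/\ metric_parallel g (cov D), J_parallel (cov D) & torsion_skew g (cov D)].

Definition gauduchon (R : realType) (n : nat) (M : topologicalType)
    (A : complexManifold R n M) (chern strominger : connection A) (r : R) :
    covDerivative A :=
  fun c X Y x => ((1 + r) / 2) *: cov chern c X Y x
               + ((1 - r) / 2) *: cov strominger c X Y x.

Definition canonical_connection (R : realType) (n : nat) (M : topologicalType)
    (A : complexManifold R n M) (levi_civita chern strominger : connection A)
    (r s : R) : covDerivative A :=
  fun c X Y x => (1 - s) *: gauduchon chern strominger r c X Y x
               + s *: cov levi_civita c X Y x.

Definition kahler_like (R : realType) (n : nat) (M : topologicalType)
    (A : complexManifold R n M) (g : hermitianMetric A)
    (D : covDerivative A) : Prop :=
  forall (c : chart A) X Y Z W,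
    vfield c X -> vfield c Y -> vfield c Z -> vfield c W ->
  forall x, img c x ->
    [/\ curvature4 g D c X Y Z W x + curvature4 g D c Y Z X W x
          + curvature4 g D c Z X Y W x = 0,
        curvature4 g D c (@J R n \o X) (@J R n \o Y) Z W x
          = curvature4 g D c X Y Z W x
      & curvature4 g D c X Y (@J R n \o Z) (@J R n \o W) x
          = curvature4 g D c X Y Z W x].

Definition kahler_form (R : realType) (n : nat) (M : topologicalType)
    (A : complexManifold R n M) (g : hermitianMetric A) (c : chart A)
    (X Y : Cvec R n -> Cvec R n) : Cvec R n -> R^o :=
  inner g c (@J R n \o X) Y.

(* The Kaehler form is closed; its exterior derivative is given by the invariant
   (Koszul) formula. *)
Definition is_kahler (R : realType) (n : nat) (M : topologicalType)
    (A : complexManifold R n M) (g : hermitianMetric A) : Prop :=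
  forall (c : chart A) X Y Z, vfield c X -> vfield c Y -> vfield c Z ->
  forall x, img c x ->
    'D_(X x) (kahler_form g c Y Z) x
    + 'D_(Y x) (kahler_form g c Z X) x
    + 'D_(Z x) (kahler_form g c X Y) x
    - kahler_form g c (lie X Y) Z x
    - kahler_form g c (lie Y Z) X x
    - kahler_form g c (lie Z X) Y x = 0.

Definition Omega (R : realType) : set (R * R) :=
  ~` [set p | p.1 != 0 /\ p.2 = 1].

Definition Omega' (R : realType) : set (R * R) :=
  @Omega R `\` ([set p | p.2 = 0] `|`
                [set p | p \in [:: (0, 1); (0, -1); (-1, 2); (1 / 3, -2)]]).

(* Main.v *)
Require Import Defs.
From HB Require Import structures.
From mathcomp Require Import all_boot all_order all_algebra.
From mathcomp Require Import sesquilinear.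
From mathcomp Require Import all_classical all_reals all_analysis.
From mathcomp Require Import ring lra.

Set Implicit Arguments.
Unset Strict Implicit.
Unset Printing Implicit Defensive.

Import Order.TTheory GRing.Theory Num.Theory.
Import numFieldNormedType.Exports.

Local Open Scope classical_set_scope.
Local Open Scope ring_scope.

(* Put t = 1 - r + r s.  The torsion T of the Chern connection is J-bilinear, and
   D^r_s = Chern + A with A_x w = (- t T_x w + t T_x^* w + s T_w^* x) / 2.
   Splitting the Kaehler-like identities for D^r_s by type (each argument of type
   (1,0) or (0,1)) determines the covariant derivative of T as a quadratic
   expression in T (if t <> 1) and yields
     4 (t - 1)^2 <T(x,y), T(z,w)> = (s^2 + 2 t - 3 t^2) quad(x,y,z,w),
     t (t - 1) T(T(x,y),z) = 0,
   with quad a combination of terms <T_x^* w, T_z^* y>.  Contracting indices gives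
   T = 0 if t is neither 0 nor 1, and also if t = 1 and s^2 <> 1, where a symmetry
   of <T_x^* w, T_z^* y> replaces the first identity.  If t = 0, T satisfies the
   Jacobi identity; the trace of the covariant derivative of that identity, combined
   with the contractions of the first identity, gives (1 - s^2/4) |T(T(.,.),.)|^2 = 0, so
   T is again nilpotent, hence zero, unless s^2 = 4.  The four excluded points are
   those where (t, s) is (1, 1), (1, -1), (0, 2) or (0, -2).  The argument uses
   first derivatives of the Christoffel symbols only. *)

(** * Tensor contractions *)

Definition bilin (R : nzRingType) (U V W : lmodType R) (f : U -> V -> W) : Prop :=
  (forall u, linear (f u)) /\ (forall v, linear (f^~ v)).

Section Bilin.
Variables (R : nzRingType) (U V W : lmodType R) (f : U -> V -> W).
Hypothesis fB : bilin f.

Lemma bilDr u v w : f u (v + w) = f u v + f u w.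
Proof. by have := fB.1 u 1 v w; rewrite !scale1r. Qed.
Lemma bilDl u v w : f (u + v) w = f u w + f v w.
Proof. by have := fB.2 w 1 u v; rewrite !scale1r. Qed.
Lemma bil0r u : f u 0 = 0.
Proof. by apply: (@addrI _ (f u 0)); rewrite -bilDr !addr0. Qed.
Lemma bil0l v : f 0 v = 0.
Proof. by apply: (@addrI _ (f 0 v)); rewrite -bilDl !addr0. Qed.
Lemma bilZr a u v : f u (a *: v) = a *: f u v.
Proof. by have := fB.1 u a v 0; rewrite bil0r !addr0. Qed.
Lemma bilZl a u v : f (a *: u) v = a *: f u v.
Proof. by have := fB.2 v a u 0; rewrite bil0l !addr0. Qed.
Lemma bilNr u v : f u (- v) = - f u v.
Proof. by rewrite -scaleN1r bilZr scaleN1r. Qed.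
Lemma bilNl u v : f (- u) v = - f u v.
Proof. by rewrite -scaleN1r bilZl scaleN1r. Qed.
Lemma bilBl u v w : f (u - v) w = f u w - f v w.
Proof. by rewrite bilDl bilNl. Qed.
Lemma bil_sumr I (r : seq I) (P : pred I) u (F : I -> V) :
  f u (\sum_(i <- r | P i) F i) = \sum_(i <- r | P i) f u (F i).
Proof. exact: (big_morph (f u) (bilDr u) (bil0r u)). Qed.
Lemma bil_suml I (r : seq I) (P : pred I) (F : I -> U) v :
  f (\sum_(i <- r | P i) F i) v = \sum_(i <- r | P i) f (F i) v.
Proof. by rewrite (big_morph (f^~ v) (fun a b => bilDl a b v) (bil0l v)). Qed.
End Bilin.

Section Pointwise.
Variables (R : realFieldType) (V : lmodType R).
Variable g : V -> V -> R.
Hypothesis gB : bilin (g : V -> V -> R^o).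
Hypothesis gC : forall u v, g u v = g v u.
Variables (m : nat) (e : 'I_m -> V).
Hypothesis eP : forall u, u = \sum_i g u (e i) *: e i.

Let gDl u v w : g (u + v) w = g u w + g v w. Proof. exact: (bilDl gB). Qed.
Let gDr u v w : g u (v + w) = g u v + g u w. Proof. exact: (bilDr gB). Qed.
Let gZl a u w : g (a *: u) w = a * g u w. Proof. exact: (bilZl gB). Qed.
Let gZr a u w : g u (a *: w) = a * g u w. Proof. exact: (bilZr gB). Qed.
Let gNl u w : g (- u) w = - g u w. Proof. exact: (bilNl gB). Qed.
Let gNr u w : g u (- w) = - g u w. Proof. exact: (bilNr gB). Qed.
Let g0l w : g 0 w = 0. Proof. exact: (bil0l gB). Qed.
Let g0r w : g w 0 = 0. Proof. exact: (bil0r gB). Qed.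
Let gsuml I (r : seq I) (F : I -> V) v :
  g (\sum_(i <- r) F i) v = \sum_(i <- r) g (F i) v.
Proof. exact: (bil_suml gB). Qed.
Let gsumr I (r : seq I) (F : I -> V) v :
  g v (\sum_(i <- r) F i) = \sum_(i <- r) g v (F i).
Proof. exact: (bil_sumr gB). Qed.

(** The hypothesis [eP] is the expansion in an orthonormal basis; pairing it with a vector writes
    [g] as a sum of products of coordinates, which yields positivity and definiteness. *)
Lemma parseval u v : \sum_i g u (e i) * g v (e i) = g u v.
Proof.
rewrite [in RHS](eP u) gsuml; apply: eq_bigr => i _.
by rewrite gZl (gC v).
Qed.

Lemma g_ge0 u : 0 <= g u u.
Proof. by rewrite -parseval; apply: sumr_ge0 => i _; rewrite -expr2 sqr_ge0. Qed.

Lemma g_eq0 u : g u u = 0 -> u = 0.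
Proof.
rewrite -parseval => /eqP; rewrite psumr_eq0 => [|i _]; last first.
  by rewrite -expr2 sqr_ge0.
move=> /allP h; rewrite (eP u) big1// => i _.
have := h i (mem_index_enum _); rewrite mulf_eq0 orbb => /eqP ->.
by rewrite scale0r.
Qed.

Lemma g_inj u v : (forall w, g u w = g v w) -> u = v.
Proof.
move=> h; apply/eqP; rewrite -subr_eq0; apply/eqP/g_eq0.
by rewrite gDl gNl h subrr.
Qed.

Lemma sum_sq_eq0 (F : 'I_m -> V) : \sum_i g (F i) (F i) = 0 -> forall i, F i = 0.
Proof.
move=> /eqP; rewrite psumr_eq0 => [/allP h i|i _]; last exact: g_ge0.
by apply: g_eq0; apply/eqP/h/mem_index_enum.
Qed.

Lemma sum_basis (W : lmodType R) (f : V -> W) u :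
  linear f -> \sum_i g u (e i) *: f (e i) = f u.
Proof.
move=> fL; have f0 : f 0 = 0.
  by have := fL (-1) 0 0; rewrite scaler0 addr0 scaleN1r addNr.
have fD x y : f (x + y) = f x + f y by have := fL 1 x y; rewrite !scale1r.
rewrite [in RHS](eP u) (big_morph f fD f0).
by apply: eq_bigr => i _; rewrite -[_ *: e i]addr0 fL f0 addr0.
Qed.

Lemma sum_basis_scalar (f : V -> R) u :
  linear (f : V -> R^o) -> \sum_i g u (e i) * f (e i) = f u.
Proof. exact: sum_basis. Qed.

Lemma trace_comp (f h : V -> V) : linear f -> linear h ->
  \sum_i g (f (h (e i))) (e i) = \sum_i g (h (f (e i))) (e i).
Proof.
have P (f' h' : V -> V) i : linear f' ->
    g (f' (h' (e i))) (e i) = \sum_j g (h' (e i)) (e j) * g (f' (e j)) (e i).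
  move=> f'L; rewrite (sum_basis_scalar (f := fun u => g (f' u) (e i)))// => a x y.
  by rewrite f'L gDl gZl.
move=> fL hL; under eq_bigr => i _ do rewrite (P f h i fL).
rewrite exchange_big; apply: eq_bigr => i _; rewrite (P h f i hL).
by apply: eq_bigr => j _; rewrite mulrC.
Qed.

Section Tensor.
Variable T : V -> V -> V.
Hypothesis TB : bilin T.
Hypothesis TC : forall x y, T x y = - T y x.

(** The metric adjoint T_x^* of [T x], given by its coordinates. *)
Definition adj x w := \sum_i g (T x (e i)) w *: e i.
Local Notation S := adj.

Lemma adjE x w z : g (S x w) z = g (T x z) w.
Proof.
rewrite /adj gsuml -(sum_basis_scalar (f := fun z => g (T x z) w)).
  by apply: eq_bigr => i _; rewrite gZl mulrC (gC z).
by move=> a u v; rewrite (bilDr TB) (bilZr TB) gDl gZl.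
Qed.

Lemma adjE' x w z : g z (S x w) = g (T x z) w.
Proof. by rewrite gC adjE. Qed.

Lemma adj_bilin : bilin S.
Proof.
split=> [x a u v|w a u v]; apply: g_inj => z; rewrite gDl gZl !adjE.
  by rewrite gDr gZr.
by rewrite (bilDl TB) (bilZl TB) gDl gZl.
Qed.
Let SB := adj_bilin.

(** The vector dual to minus the trace of T_z, that is, the torsion 1-form up to sign. *)
Definition tr_vec := \sum_i S (e i) (e i).
Local Notation om := tr_vec.

Lemma tr_vecE z : g om z = - \sum_i g (T z (e i)) (e i).
Proof.
rewrite gsuml -sumrN; apply: eq_bigr => i _.
by rewrite adjE TC gNl.
Qed.

Lemma sum_adj_adj x y : \sum_i g (S x (e i)) (S y (e i)) = \sum_i g (T x (e i)) (T y (e i)).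
Proof.
under eq_bigr do rewrite -parseval.
rewrite exchange_big; apply: eq_bigr => i _; rewrite -parseval.
by apply: eq_bigr => j _; rewrite !adjE.
Qed.

(** Summing the hypothesis over y = w equates the Hilbert-Schmidt product of T_x and T_z with <T(z,
    om), x>. For x = z = om the latter is zero by skewness, so T_om = 0; it then vanishes for every
    x = z. *)
Lemma adj_sym_eq0 :
  (forall x y z w, g (S x w) (S z y) = g (S y w) (S z x)) -> forall x y, T x y = 0.
Proof.
move=> h.
have h1 x z : \sum_i g (S x (e i)) (S z (e i)) = g (T z om) x.
  by rewrite -adjE' gsuml; apply: eq_bigr => i _; exact: h.
have om0 x : T om x = 0.
  have : \sum_i g (T om (e i)) (T om (e i)) = 0.
    rewrite -sum_adj_adj h1.
    have : T om om = 0.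
      by apply: g_eq0; have := congr1 (g (T om om)) (TC om om); rewrite gNr; lra.
    by move=> ->; rewrite g0l.
  move=> /sum_sq_eq0 h0; rewrite -(sum_basis _ (TB.1 om)) big1// => i _.
  by rewrite h0 scaler0.
move=> x y; have : \sum_i g (T x (e i)) (T x (e i)) = 0.
  by rewrite -sum_adj_adj h1 TC om0 oppr0 g0l.
move=> /sum_sq_eq0 h0; rewrite -(sum_basis _ (TB.1 x)) big1// => i _.
by rewrite h0 scaler0.
Qed.

(** A positive semidefinite form whose null vectors are those orthogonal to the image of [T]. *)
Definition ricci_form x y := \sum_i \sum_j g (T (e i) (e j)) x * g (T (e i) (e j)) y.
Local Notation G := ricci_form.

Lemma sum_adjl x y : \sum_i g (S (e i) x) (S (e i) y) = G x y.
Proof.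
apply: eq_bigr => i _; rewrite -parseval; apply: eq_bigr => j _.
by rewrite !adjE.
Qed.

Lemma basis2_eq0 : (forall i j, T (e i) (e j) = 0) -> forall x y, T x y = 0.
Proof.
move=> h x y; rewrite -(sum_basis _ (TB.1 x)) big1// => i _.
rewrite -(sum_basis _ (TB.2 (e i))) big1 ?scaler0// => j _.
by rewrite h scaler0.
Qed.

Definition quad x y z w :=
  g (S x w) (S z y) - g (S y w) (S z x) - g (S x z) (S w y) + g (S y z) (S w x).

(** If u lies in the image of [T], then T_u = 0 and T_u^* = 0, so the first hypothesis makes <S_y w,
    S_z u> symmetric in z and w. Tracing over y = w gives <T(z, om), u> = G(z, u). A further trace
    with T(T(.,.),.) = 0 kills T(., om), hence G(z, u) = 0, and z = u forces u = 0. *)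
Lemma nilpotent_eq0 k :
  (forall x y z w, g (T x y) (T z w) = k * quad x y z w) ->
  (forall x y z, T (T x y) z = 0) -> forall x y, T x y = 0.
Proof.
move=> h TT0.
have [k0|k0] := eqVneq k 0.
  by move=> x y; apply: g_eq0; rewrite h k0 mul0r.
have S0 p q w : S (T p q) w = 0.
  by apply: g_inj => z; rewrite adjE TT0 !g0l.
have h1 p q y z w : g (S y w) (S z (T p q)) = g (S y z) (S w (T p q)).
  have := h (T p q) y z w; rewrite /quad TT0 !S0 !g0l.
  move=> /esym /eqP; rewrite mulf_eq0 (negPf k0) /= sub0r subr0 addrC subr_eq0.
  by move=> /eqP.
have h2 p q z : g (T z om) (T p q) = G z (T p q).
  rewrite -adjE' -sum_adjl gsuml; apply: eq_bigr => i _; exact: h1.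
have om0 z : T z om = 0.
  rewrite -(sum_basis _ (TB.2 om)) big1// => i _.
  suff /sum_sq_eq0 -> : \sum_i g (T (e i) om) (T (e i) om) = 0 by rewrite scaler0.
  under eq_bigr do rewrite h2 /ricci_form.
  rewrite exchange_big big1// => j _; rewrite exchange_big big1// => l _.
  rewrite (sum_basis_scalar (f := fun u => g (T (e j) (e l)) (T u om))).
    by rewrite TT0 g0r.
  by move=> a u v; rewrite (bilDl TB) (bilZl TB) gDr gZr.
apply: basis2_eq0 => a b; apply: g_eq0.
have := h2 (e a) (e b) (T (e a) (e b)); rewrite om0 g0l => /esym /eqP.
rewrite psumr_eq0 => [/allP/(_ a (mem_index_enum _))/=|i _]; last first.
  by apply: sumr_ge0 => j _; rewrite -expr2 sqr_ge0.
rewrite psumr_eq0 => [/allP/(_ b (mem_index_enum _))/=|j _]; last first.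
  by rewrite -expr2 sqr_ge0.
by rewrite mulf_eq0 orbb => /eqP.
Qed.

(** * Contractions for a torsion satisfying the Jacobi identity *)

Hypothesis jacobi : forall x y z, T (T x y) z + T (T y z) x + T (T z x) y = 0.

Let TNl x y : T (- x) y = - T x y. Proof. exact: (bilNl TB). Qed.
Let TNr x y : T x (- y) = - T x y. Proof. exact: (bilNr TB). Qed.
Let sumBr I (r : seq I) (F H : I -> R) :
  \sum_(i <- r) (F i - H i) = \sum_(i <- r) F i - \sum_(i <- r) H i.
Proof. exact: sumrB. Qed.

Lemma jacobi_derivation x y z : T x (T y z) = T (T x y) z + T y (T x z).
Proof.
have := jacobi x y z; rewrite (TC (T y z)) (TC (T z x)) (TC z x) TNr opprK.
by move=> /eqP; rewrite addrAC subr_eq0 => /eqP ->.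
Qed.

Variable DT : V -> V -> V -> V.
Hypothesis DTB : forall v, bilin (DT v).
Hypothesis DTC : forall v x y, DT v x y = - DT v y x.
Hypothesis djacobi : forall v x y z,
  DT v (T x y) z + T (DT v x y) z + (DT v (T y z) x + T (DT v y z) x) +
  (DT v (T z x) y + T (DT v z x) y) = 0.

(** The derivative along v of the Lie algebra identity tr ad [x, y] = 0: in the trace of [djacobi]
    over its last argument the remaining terms form commutators, whose traces cancel by
    [trace_comp]. *)
Lemma tr_vec_dbracket v x y :
  \sum_i g (DT v (T x y) (e i)) (e i) = g om (DT v x y).
Proof.
rewrite tr_vecE; apply/eqP; rewrite -addr_eq0 -big_split/=; apply/eqP.
have E i : g (DT v (T x y) (e i)) (e i) + g (T (DT v x y) (e i)) (e i) =
    (g (DT v x (T y (e i))) (e i) - g (T y (DT v x (e i))) (e i)) +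
    (g (T x (DT v y (e i))) (e i) - g (DT v y (T x (e i))) (e i)).
  have := congr1 (g^~ (e i)) (djacobi v x y (e i)).
  rewrite (DTC v (T y _)) (DTC v (T (e i) x)) (TC (e i) x) (TC (DT v y _)).
  rewrite (DTC v (e i)) (TC (- _) y) !(bilNr (DTB v)) TNr.
  by rewrite !gDl !gNl g0l; lra.
under eq_bigr do rewrite E.
rewrite big_split/= !sumBr (trace_comp ((DTB v).1 x) (TB.1 y)).
by rewrite (trace_comp (TB.1 x) ((DTB v).1 y)); ring.
Qed.

Variable k : R.
Hypothesis k0 : k != 0.
Hypothesis k1 : k != 1.
Hypothesis TT_quad : forall x y z w, g (T x y) (T z w) = k * quad x y z w.
Hypothesis DTE : forall v x y z,
  g (DT v x y) z = k * (g (S x v) (S z y) - g (S y v) (S z x)).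

(* The trace of [djacobi], with the derivatives eliminated by [DTE]. *)
Let ricci_identity x y v : g (T (T x y) om) v - G (T x y) v
  - g (S x v) (S om y) + g (S y v) (S om x) = 0.
Proof.
apply: (mulfI k0); rewrite mulr0.
have := tr_vec_dbracket v x y; rewrite (gC om) DTE.
under eq_bigr do rewrite DTE.
rewrite -mulr_sumr sumBr sum_adjl.
have -> : \sum_i g (S (T x y) v) (S (e i) (e i)) = g (T (T x y) om) v.
  by rewrite -gsumr adjE.
have -> : G v (T x y) = G (T x y) v.
  by apply: eq_bigr => i _; apply: eq_bigr => j _; rewrite mulrC.
by lra.
Qed.

Let n := \sum_i \sum_j g (T om (T (e i) (e j))) (T (e i) (e j)).
Let Phi := \sum_i \sum_j G (T (e i) (e j)) (T (e i) (e j)).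
Let Y := \sum_i \sum_j g (T (e i) (T om (e j))) (T (e i) (e j)).

(** T_om is a derivation of [T]; its action on the two arguments of T(e_i, e_j) contributes two
    equal sums. *)
Let n_Y : n = Y + Y.
Proof.
have -> : n = \sum_i \sum_j (g (T (e j) (T om (e i))) (T (e j) (e i))
                         + g (T (e i) (T om (e j))) (T (e i) (e j))).
  apply: eq_bigr => i _; apply: eq_bigr => j _.
  by rewrite jacobi_derivation (TC (T om _)) (TC (e i) (e j)) gDl gNl !gNr; ring.
under eq_bigr do rewrite big_split/=.
by rewrite big_split/= exchange_big.
Qed.

(** T_om may be replaced by its adjoint because sum_i <T(e_i, e_l), T(e_i, e_j)> is symmetric in j
    and l. *)
Let adj_Y : \sum_i \sum_j g (T (e i) (S om (e j))) (T (e i) (e j)) = Y.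
Proof.
have P (h : V -> V) i j : \sum_l g (h (e j)) (e l) * g (T (e i) (e l)) (T (e i) (e j))
    = g (T (e i) (h (e j))) (T (e i) (e j)).
  rewrite (sum_basis_scalar (f := fun u => g (T (e i) u) (T (e i) (e j))))//.
  by move=> a x y; rewrite (bilDr TB) (bilZr TB) gDl gZl.
apply: eq_bigr => i _.
under eq_bigr => j _ do rewrite -(P (S om)).
under [RHS]eq_bigr => j _ do rewrite -(P (T om)).
rewrite exchange_big; apply: eq_bigr => j _; apply: eq_bigr => l _.
by rewrite adjE (gC (T (e i) _)).
Qed.

(** [ricci_identity] at x = e_i, y = e_j, v = T(e_i, e_j), summed over i and j, reads - n - Phi - 2
    Y = 0. *)
Let Phi_n : Phi = - (n + n).
Proof.
have : \sum_i \sum_j (g (T (T (e i) (e j)) om) (T (e i) (e j))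
    - G (T (e i) (e j)) (T (e i) (e j))
    - g (S (e i) (T (e i) (e j))) (S om (e j))
    + g (S (e j) (T (e i) (e j))) (S om (e i))) = 0.
  by apply: big1 => i _; apply: big1 => j _; rewrite ricci_identity.
under eq_bigr do rewrite big_split/= !sumBr.
rewrite big_split/= !sumBr.
have -> : \sum_i \sum_j g (T (T (e i) (e j)) om) (T (e i) (e j)) = - n.
  rewrite -sumrN; apply: eq_bigr => i _; rewrite -sumrN; apply: eq_bigr => j _.
  by rewrite TC gNl.
have E : \sum_i \sum_j g (S (e i) (T (e i) (e j))) (S om (e j)) = Y.
  by rewrite -adj_Y; apply: eq_bigr => i _; apply: eq_bigr => j _; rewrite adjE.
have -> : \sum_i \sum_j g (S (e j) (T (e i) (e j))) (S om (e i)) = - Y.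
  rewrite -E exchange_big -sumrN; apply: eq_bigr => i _.
  rewrite -sumrN; apply: eq_bigr => j _.
  by rewrite TC (bilNr SB) gNl.
by rewrite E n_Y -/Phi; lra.
Qed.

(* Contracting [TT_quad] once gives (1 - k) sum |T(u, .)|^2 = k (2 g(T(om, u), u) + G(u, u));
   for u = T(e_i, e_j), the right-hand side sums to k (2 n + Phi) = 0. *)
Lemma jacobi_nilpotent x y z : T (T x y) z = 0.
Proof.
pose H u := \sum_l g (T u (e l)) (T u (e l)).
have HE u : H u = k * (H u + (g (T om u) u + g (T om u) u) + G u u).
  rewrite {1}/H; under eq_bigr do rewrite TT_quad /quad.
  rewrite -mulr_sumr big_split/= !sumBr sum_adj_adj sum_adjl -gsuml -gsumr.
  by rewrite -/om (gC _ om) adjE' (TC u om) gNl -/(H u) !opprK addrA.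
have : \sum_i \sum_j H (T (e i) (e j)) = 0.
  have /eqP : \sum_i \sum_j H (T (e i) (e j)) =
     k * \sum_i \sum_j H (T (e i) (e j)).
    under [LHS]eq_bigr => i _ do under eq_bigr => j _ do rewrite HE.
    under [LHS]eq_bigr => i _ do rewrite -mulr_sumr !big_split/=.
    by rewrite -mulr_sumr !big_split/= -/n -/Phi Phi_n addrK.
  by rewrite -subr_eq0 -{1}[X in X - _]mul1r -mulrBl mulf_eq0 subr_eq0 eq_sym (negPf k1) => /eqP.
have Hge u : 0 <= H u by apply: sumr_ge0 => l _; exact: g_ge0.
move=> /eqP; rewrite psumr_eq0 => [/allP hi|i _]; last by apply: sumr_ge0 => j _.
have T0 u i j : T (T (e i) (e j)) u = 0.
  have := hi i (mem_index_enum _); rewrite /= psumr_eq0// => /allP/(_ j (mem_index_enum _))/eqP.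
  move=> /sum_sq_eq0 h; rewrite -(sum_basis _ (TB.1 _)) big1// => l _.
  by rewrite h scaler0.
rewrite -(sum_basis y (TB.1 x)) (bil_suml TB) big1// => j _.
rewrite -(sum_basis x (TB.2 (e j))) (bilZl TB) (bil_suml TB) big1 ?scaler0// => i _.
by rewrite (bilZl TB) T0 scaler0.
Qed.

End Tensor.
End Pointwise.

(** * Existence of orthonormal bases *)

Lemma orthonormal_basis (R : rcfType) (m : nat) (g : 'rV[R]_m -> 'rV[R]_m -> R) :
  bilin (g : _ -> _ -> R^o) -> (forall u v, g u v = g v u) ->
  (forall u, u != 0 -> 0 < g u u) ->
  exists k (e : 'I_k -> 'rV[R]_m), forall u, u = \sum_i g u (e i) *: e i.
Proof.
move=> gB gC gpos.
have gDl u v w : g (u + v) w = g u w + g v w by exact: (bilDl gB).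
have gNl u w : g (- u) w = - g u w by exact: (bilNl gB).
have gZl a u w : g (a *: u) w = a * g u w by exact: (bilZl gB).
have gZr a u w : g u (a *: w) = a * g u w by exact: (bilZr gB).
have gsum k (F : 'I_k -> 'rV[R]_m) w : g (\sum_i F i) w = \sum_i g (F i) w.
  exact: (bil_suml gB).
pose on k (e : 'I_k -> 'rV[R]_m) := forall i j, g (e i) (e j) = (i == j)%:R.
have comb k (e : 'I_k -> 'rV[R]_m) (c : 'I_k -> R) j : on k e ->
    g (\sum_i c i *: e i) (e j) = c j.
  move=> one; rewrite gsum (bigD1 j)//= gZl one eqxx mulr1 big1 ?addr0// => i ij.
  by rewrite gZl one (negPf ij) mulr0.
(* If no family expands every vector, the normalized remainder of a vector that is not expanded
   prolongs any orthonormal family. *)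
apply: contrapT => nobasis.
have step k (e : 'I_k -> 'rV[R]_m) : on k e -> exists e', on k.+1 e'.
  move=> one; have [u hu] : exists u, u <> \sum_i g u (e i) *: e i.
    by apply/existsNP => h; apply: nobasis; exists k, e.
  pose v := u - \sum_i g u (e i) *: e i.
  have v0 : v != 0 by rewrite subr_eq0; apply/eqP.
  have vpos := gpos v v0; have vs : Num.sqrt (g v v) != 0 by rewrite gt_eqF// sqrtr_gt0.
  have ve j : g v (e j) = 0 by rewrite gDl gNl comb// subrr.
  exists (fun i => if unlift ord0 i is Some j then e j else (Num.sqrt (g v v))^-1 *: v).
  move=> i j; case: unliftP => [i'|] ->; case: unliftP => [j'|] ->.
  - by rewrite one (inj_eq lift_inj).
  - by rewrite gZr gC ve mulr0.
  - by rewrite gZl ve mulr0.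
  rewrite gZl gZr eqxx mulrA -invfM -expr2 sqr_sqrtr ?mulVf ?gt_eqF//.
  exact: ltW.
(* There would be m + 1 orthonormal vectors in dimension m. The matrix of these rows has a nonzero
   vector in its left kernel, yet its coordinates are inner products of the zero vector. *)
have [e one] : exists e, on m.+1 e.
  elim: m.+1 => [|k [e /step //]].
  by exists (fun=> 0) => -[].
pose B := \matrix_i e i.
have : kermx B != 0.
  by rewrite -mxrank_eq0 mxrank_ker -lt0n subn_gt0 ltnS rank_leq_col.
move=> /rowV0Pn[c /sub_kermxP cB /eqP]; apply; apply/rowP => j; rewrite mxE.
rewrite -(comb _ e (fun i => c ord0 i) j one).
move: cB; rewrite mulmx_sum_row (eq_bigr (fun i => c ord0 i *: e i)) => [->|i _].
  exact: (bil0l gB).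
by rewrite rowK.
Qed.

(** * Type decomposition of the Kaehler-like identities *)

Section Types.
Variables (R : realFieldType) (V : lmodType R) (J : V -> V).
Hypothesis JJ : forall u, J (J u) = - u.

(* Real form of "multilinear or antilinear in each argument": the bits tell whether
   the second, third and fourth arguments have the same type as the first. *)
Definition typed (y z w : bool) (F : V -> V -> V -> V -> R) := forall a b c d,
  [/\ F (J a) (J b) c d = (-1) ^+ y * F a b c d,
      F (J a) b (J c) d = (-1) ^+ z * F a b c d,
      F (J a) b c (J d) = (-1) ^+ w * F a b c d
    & F (- a) b c d = - F a b c d].

(** Since J^2 = -1, two further copies of [J] can be placed in the first argument at the cost of a
    sign; each is then paired with one of the other two. *)
Lemma typed34 y z w F a b c d : typed y z w F ->
  F a b (J c) (J d) = - (-1) ^+ (z (+) w) * F a b c d.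
Proof.
move=> tF; have [_ _ _ N] := tF a b (J c) (J d).
have [_ e2 _ _] := tF (J a) b c (J d).
have [_ _ e3 _] := tF a b c d.
rewrite -[LHS]opprK -N -JJ e2 e3 mulrA -signr_addb mulNr.
by rewrite signr_addb.
Qed.

Lemma typed24 y z w F a b c d : typed y z w F ->
  F a (J b) c (J d) = - (-1) ^+ (y (+) w) * F a b c d.
Proof.
move=> tF; have [_ _ _ N] := tF a (J b) c (J d).
have [e1 _ _ _] := tF (J a) b c (J d).
have [_ _ e3 _] := tF a b c d.
by rewrite -[LHS]opprK -N -JJ e1 e3 mulrA -signr_addb mulNr.
Qed.

Lemma typed23 y z w F a b c d : typed y z w F ->
  F a (J b) (J c) d = - (-1) ^+ (y (+) z) * F a b c d.
Proof.
move=> tF; have [_ _ _ N] := tF a (J b) (J c) d.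
have [e1 _ _ _] := tF (J a) b (J c) d.
have [_ e2 _ _] := tF a b c d.
by rewrite -[LHS]opprK -N -JJ e1 e2 mulrA -signr_addb mulNr.
Qed.

Definition type_sum (F : bool -> bool -> bool -> V -> V -> V -> V -> R) a b c d :=
  F true true true a b c d + F true true false a b c d +
  F true false true a b c d + F true false false a b c d +
  F false true true a b c d + F false true false a b c d +
  F false false true a b c d + F false false false a b c d.

(** Applying [J] to an even number of arguments multiplies each of the eight components by a sign.
    The eight such substitutions give an invertible linear system for the components. *)
Lemma separate F : (forall y z w, typed y z w (F y z w)) ->
  (forall a b c d, type_sum F a b c d = 0) ->
  forall y z w a b c d, F y z w a b c d = 0.
Proof.
move=> tF F0 y z w a b c d.
have h y' z' w' := tF y' z' w' a b c d.
have h34 y' z' w' := typed34 a b c d (tF y' z' w').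
have h24 y' z' w' := typed24 a b c d (tF y' z' w').
have h23 y' z' w' := typed23 a b c d (tF y' z' w').
have := F0 a b c d; have := F0 (J a) (J b) c d; have := F0 (J a) b (J c) d.
have := F0 (J a) b c (J d); have := F0 a b (J c) (J d); have := F0 a (J b) c (J d).
have := F0 a (J b) (J c) d; have := F0 (J a) (J b) (J c) (J d).
have h4 y' z' w' : F y' z' w' (J a) (J b) (J c) (J d) =
    - (-1) ^+ (z' (+) w') * ((-1) ^+ y' * F y' z' w' a b c d).
  by rewrite (typed34 _ _ _ _ (tF y' z' w')); have [->] := h y' z' w'.
rewrite /type_sum !h4 !h34 !h24 !h23.
have [-> -> -> _] := h true true true; have [-> -> -> _] := h true true false.
have [-> -> -> _] := h true false true; have [-> -> -> _] := h true false false.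
have [-> -> -> _] := h false true true; have [-> -> -> _] := h false true false.
have [-> -> -> _] := h false false true; have [-> -> -> _] := h false false false.
rewrite /= !expr0 !expr1 => *.
by case: y; case: z; case: w; lra.
Qed.

End Types.

(** * Torsion identities at a single point *)

Section KahlerLike.
Variables (R : realFieldType) (V : lmodType R).
Variables (g : V -> V -> R) (J : V -> V).
Hypothesis gB : bilin (g : V -> V -> R^o).
Hypothesis gC : forall u v, g u v = g v u.
Hypothesis JL : linear J.
Hypothesis JJ : forall u, J (J u) = - u.
Hypothesis gJJ : forall u v, g (J u) (J v) = g u v.
Variables (m : nat) (e : 'I_m -> V).
Hypothesis eP : forall u, u = \sum_i g u (e i) *: e i.
Variable T : V -> V -> V.
Hypothesis TB : bilin T.
Hypothesis TC : forall x y, T x y = - T y x.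
Hypothesis TJl : forall x y, T (J x) y = J (T x y).

Let gDl u v w : g (u + v) w = g u w + g v w. Proof. exact: (bilDl gB). Qed.
Let gDr u v w : g u (v + w) = g u v + g u w. Proof. exact: (bilDr gB). Qed.
Let gZl a u w : g (a *: u) w = a * g u w. Proof. exact: (bilZl gB). Qed.
Let gZr a u w : g u (a *: w) = a * g u w. Proof. exact: (bilZr gB). Qed.
Let gNl u w : g (- u) w = - g u w. Proof. exact: (bilNl gB). Qed.
Let gNr u w : g u (- w) = - g u w. Proof. exact: (bilNr gB). Qed.
Let gJl u v : g (J u) v = - g u (J v).
Proof. by rewrite -(gJJ u) JJ gNr opprK. Qed.
Let JN u : J (- u) = - J u.
Proof.
have J0 : J 0 = 0 by have := JL (-1) 0 0; rewrite scaler0 addr0 scaleN1r addNr.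
by have := JL (-1) u 0; rewrite !scaleN1r J0 !addr0.
Qed.

Local Notation S := (adj g e T).
Let SE x w z : g (S x w) z = g (T x z) w. Proof. exact: adjE. Qed.
Let SE' x w z : g z (S x w) = g (T x z) w. Proof. exact: adjE'. Qed.
Let SB : bilin S. Proof. exact: adj_bilin. Qed.

Let TJr x y : T x (J y) = J (T x y).
Proof. by rewrite TC TJl TC JN opprK. Qed.
Let SJl x y : S (J x) y = - J (S x y).
Proof.
by apply: (g_inj gB gC eP) => w; rewrite SE TJl gNl (gJl (S x y)) opprK SE TJr.
Qed.
Let SJr x y : S x (J y) = J (S x y).
Proof. by apply: (g_inj gB gC eP) => w; rewrite SE (gJl (S x y)) SE TJr gJl opprK. Qed.
Let TNl x y : T (- x) y = - T x y. Proof. exact: (bilNl TB). Qed.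
Let SNl x y : S (- x) y = - S x y. Proof. exact: (bilNl SB). Qed.
Let TNr x y : T x (- y) = - T x y. Proof. exact: (bilNr TB). Qed.
Let SNr x y : S x (- y) = - S x y. Proof. exact: (bilNr SB). Qed.

Variable DT : V -> V -> V -> V.
Hypothesis DTB : forall v, bilin (DT v).
Hypothesis DTN : forall v x y, DT (- v) x y = - DT v x y.
Hypothesis DTC : forall v x y, DT v x y = - DT v y x.
Hypothesis DTJl : forall v x y, DT v (J x) y = J (DT v x y).
Let DTJr v x y : DT v x (J y) = J (DT v x y).
Proof. by rewrite DTC DTJl DTC JN opprK. Qed.

Let TT a b c d := g (T a b) (T c d).
Let SS a b c d := g (S a b) (S c d).
Let q a b c d := g (T a (T b c)) d.
Let d0 v x y w := g (DT v x y) w.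
(* The parts of the covariant derivative of T that are J-linear and J-antilinear
   in the direction of differentiation. *)
Let d1 v x y w := (d0 v x y w + d0 (J v) x y (J w)) / 2.
Let d2 v x y w := (d0 v x y w - d0 (J v) x y (J w)) / 2.

Let d0E v x y w : d0 v x y w = d1 v x y w + d2 v x y w.
Proof. by rewrite /d1 /d2; lra. Qed.

(** Rewriting rules that move each [J] into the last argument and each sign to the front; the
    analogous rules below serve the same normalization. *)
Let TTJ a b c d : (TT (J a) b c d = - TT a b c (J d)) *
  (TT a (J b) c d = - TT a b c (J d)) * (TT a b (J c) d = TT a b c (J d)) *
  (TT a b c (J (J d)) = - TT a b c d) * (TT (- a) b c d = - TT a b c d) *
  (TT a (- b) c d = - TT a b c d) * (TT a b (- c) d = - TT a b c d) *
  (TT a b c (- d) = - TT a b c d).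
Proof.
rewrite /TT JJ ?TNl ?TNr ?gNl ?gNr; do !split => //; rewrite ?TJl ?TJr // gJl.
Qed.
Let SSJ a b c d : (SS (J a) b c d = SS a b c (J d)) *
  (SS a (J b) c d = - SS a b c (J d)) * (SS a b (J c) d = - SS a b c (J d)) *
  (SS a b c (J (J d)) = - SS a b c d) * (SS (- a) b c d = - SS a b c d) *
  (SS a (- b) c d = - SS a b c d) * (SS a b (- c) d = - SS a b c d) *
  (SS a b c (- d) = - SS a b c d).
Proof.
rewrite /SS JJ ?SNl ?SNr ?gNl ?gNr; do !split => //;
by rewrite ?SJl ?SJr ?gNl ?gNr ?gJl ?opprK.
Qed.
Let qJ a b c d : (q (J a) b c d = - q a b c (J d)) *
  (q a (J b) c d = - q a b c (J d)) * (q a b (J c) d = - q a b c (J d)) *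
  (q a b c (J (J d)) = - q a b c d) * (q (- a) b c d = - q a b c d) *
  (q a (- b) c d = - q a b c d) * (q a b (- c) d = - q a b c d) *
  (q a b c (- d) = - q a b c d).
Proof.
rewrite /q JJ ?TNl ?TNr ?gNl ?gNr; do !split => //;
by rewrite ?TJl ?TJr ?TNr ?TJr ?gNl ?gNr ?gJl ?opprK.
Qed.
Let d0J a b c d : (d0 a (J b) c d = - d0 a b c (J d)) *
  (d0 a b (J c) d = - d0 a b c (J d)) *
  (d0 a b c (J (J d)) = - d0 a b c d) * (d0 (- a) b c d = - d0 a b c d) *
  (d0 a (- b) c d = - d0 a b c d) * (d0 a b (- c) d = - d0 a b c d) *
  (d0 a b c (- d) = - d0 a b c d).
Proof.
rewrite /d0 JJ DTN !(bilNl (DTB _)) !(bilNr (DTB _)) ?gNl ?gNr; do !split => //;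
by rewrite ?DTJl ?DTJr ?gJl.
Qed.
Let d1J a b c d : (d1 (J a) b c d = - d1 a b c (J d)) *
  (d1 a (J b) c d = - d1 a b c (J d)) * (d1 a b (J c) d = - d1 a b c (J d)) *
  (d1 a b c (J (J d)) = - d1 a b c d) * (d1 (- a) b c d = - d1 a b c d) *
  (d1 a (- b) c d = - d1 a b c d) * (d1 a b (- c) d = - d1 a b c d) *
  (d1 a b c (- d) = - d1 a b c d).
Proof.
rewrite /d1; do !split; rewrite ?(JJ, JN, d0J); lra.
Qed.
Let d2J a b c d : (d2 (J a) b c d = d2 a b c (J d)) *
  (d2 a (J b) c d = - d2 a b c (J d)) * (d2 a b (J c) d = - d2 a b c (J d)) *
  (d2 a b c (J (J d)) = - d2 a b c d) * (d2 (- a) b c d = - d2 a b c d) *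
  (d2 a (- b) c d = - d2 a b c d) * (d2 a b (- c) d = - d2 a b c d) *
  (d2 a b c (- d) = - d2 a b c d).
Proof.
rewrite /d2; do !split; rewrite ?(JJ, JN, d0J); lra.
Qed.

Variables (t s : R).
Variables (A : V -> V -> V) (DA : V -> V -> V -> V) (Rc : V -> V -> V -> V -> R).
Hypothesis AE : forall x w z,
  g (A x w) z = (- t * g (T x w) z + t * g (T x z) w + s * g (T w z) x) / 2.
Hypothesis DAE : forall v x w z, g (DA v x w) z =
  (- t * g (DT v x w) z + t * g (DT v x z) w + s * g (DT v w z) x) / 2.

(** Curvature of Chern + A minus curvature of Chern: (D_x A)_y - (D_y A)_x + A_{T(x,y)} +
    [A_x, A_y], with D the Chern connection. *)
Definition curv_diff x y z w := g (DA x y z) w - g (DA y x z) w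
  + g (A (T x y) z) w + g (A x (A y z)) w - g (A y (A x z)) w.
Local Notation E := curv_diff.

Let A_skew x y z : g (A x y) z = - g (A x z) y.
Proof. by rewrite !AE (TC z y) gNl; lra. Qed.

Let AvE x w : A x w = 2^-1 *: (- t *: T x w + t *: S x w + s *: S w x).
Proof.
apply: (g_inj gB gC eP) => z; rewrite AE gZl !gDl !gZl !SE; lra.
Qed.

Let AA x y z w : g (A y z) (A x w) = (t ^+ 2 * TT y z x w - t ^+ 2 * q x y z w
   - t * s * q w y z x - t ^+ 2 * q y x w z + t ^+ 2 * SS y z x w
   + t * s * SS y z w x - s * t * q z x w y + s * t * SS z y x w
   + s ^+ 2 * SS z y w x) / 4.
Proof.
have hTS a b c d : g (T a b) (S c d) = q c a b d by exact: SE'.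
have hST a b c d : g (S a b) (T c d) = q a c d b by exact: SE.
by rewrite !AvE !(gZl, gDl, gZr, gDr) !hTS !hST -!/(TT _ _ _ _) -!/(SS _ _ _ _); field.
Qed.

Let SSC a b c d : SS a b c d = SS c d a b. Proof. exact: gC. Qed.

Let EE x y z w : E x y z w =
  (- t * d0 x y z w + t * d0 x y w z + s * d0 x z w y
   + t * d0 y x z w - t * d0 y x w z - s * d0 y z w x
   + t * q z x y w - t * q w x y z + s * TT z w x y) / 2
  - (t ^+ 2 * TT y z x w - t ^+ 2 * q x y z w
   - t * s * q w y z x - t ^+ 2 * q y x w z + t ^+ 2 * SS y z x w
   + t * s * SS y z w x - s * t * q z x w y + s * t * SS z y x w
   + s ^+ 2 * SS z y w x) / 4
  + (t ^+ 2 * TT x z y w - t ^+ 2 * q y x z w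
   - t * s * q w x z y - t ^+ 2 * q x y w z + t ^+ 2 * SS x z y w
   + t * s * SS x z w y - s * t * q z y w x + s * t * SS z x y w
   + s ^+ 2 * SS z x w y) / 4.
Proof.
rewrite /curv_diff !DAE AE (A_skew x (A y z)) (A_skew y (A x z)) !(gC (A _ w)) !AA.
rewrite -!/(d0 _ _ _ _) (TC _ z) (TC _ w) !gNl -/(q z x y w) -/(q w x y z).
by rewrite -/(TT z w x y); field.
Qed.

(* Components of [E] by type, indexed as in [typed]. *)
Let Ec (by_ bz bw : bool) x y z w : R :=
  match by_, bz, bw with
  | true, true, true => 0
  | true, true, false =>
      t / 2 * (d1 y x z w - d1 x y z w + q z x y w)
      + t ^+ 2 / 4 * (q x y z w - q y x z w)
  | true, false, true =>
      t / 2 * (d1 x y w z - d1 y x w z - q w x y z)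
      + t ^+ 2 / 4 * (q y x w z - q x y w z)
  | false, true, true =>
      s / 2 * d1 x z w y + t * s / 4 * (q z x w y - q w x z y)
  | false, false, false =>
      - (s / 2 * d1 y z w x) + t * s / 4 * (q w y z x - q z y w x)
  | true, false, false =>
      s / 2 * (d2 x z w y - d2 y z w x + TT z w x y)
      + t * s / 4 * (SS x z w y + SS z x y w - SS y z w x - SS z y x w)
  | false, true, false =>
      t / 2 * (d2 y x z w + d2 x y w z)
      + (t ^+ 2 * (TT x z y w - SS y z x w) - s ^+ 2 * SS z y w x) / 4
  | false, false, true =>
      - (t / 2 * (d2 x y z w + d2 y x w z))
      + (t ^+ 2 * (SS x z y w - TT y z x w) + s ^+ 2 * SS z x w y) / 4
  end.

Let EcE x y z w : E x y z w = type_sum Ec x y z w.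
Proof. by rewrite EE /type_sum /Ec !d0E; field. Qed.

Let Ec_typed y z w : typed J y z w (Ec y z w).
Proof.
case: y; case: z; case: w => a b c d /=; rewrite ?expr0 ?expr1;
  split; rewrite ?(TTJ, SSJ, qJ, d1J, d2J); ring.
Qed.

Hypothesis RcN : forall x y z w, Rc (- x) y z w = - Rc x y z w.
Hypothesis RcJ : forall x y z w, Rc x y (J z) (J w) = Rc x y z w.
Hypothesis Rc_bianchi : forall x y z w, Rc x y z w + Rc y z x w + Rc z x y w =
  g (DT x y z) w + g (DT y z x) w + g (DT z x y) w
  + (g (T (T x y) z) w + g (T (T y z) x) w + g (T (T z x) y) w).
(* The (0,2) part of the Chern curvature vanishes on (1,0) vectors. *)
Hypothesis Rc02 : forall x y z w,
  Rc x y z w - Rc (J x) (J y) z w - Rc (J x) y z (J w) - Rc x (J y) z (J w) = 0.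
Variable RD : V -> V -> V -> V -> R.
Hypothesis RDE : forall x y z w, RD x y z w = Rc x y z w + E x y z w.
Hypothesis RD_bianchi : forall x y z w, RD x y z w + RD y z x w + RD z x y w = 0.
Hypothesis RDJ12 : forall x y z w, RD (J x) (J y) z w = RD x y z w.
Hypothesis RDJ34 : forall x y z w, RD x y (J z) (J w) = RD x y z w.

(** Both curvatures are J-invariant in the last two arguments, hence so is their difference, while a
    component in which these arguments have the same type changes sign. *)
Let EJ34 y z w a b c d : z == w -> Ec y z w a b c d = 0.
Proof.
pose F y z w a b c d := if z == w then Ec y z w a b c d else 0.
move=> zw; suff : F y z w a b c d = 0 by rewrite /F zw.
apply: (separate JJ) => {y z w a b c d zw} [y z w a b c d|a b c d].
  rewrite /F; case: ifP => _; first exact: Ec_typed.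
  by split; rewrite ?mulr0 ?oppr0.
have : E a b (J c) (J d) = E a b c d.
  by have := RDJ34 a b c d; rewrite !RDE RcJ => /addrI.
rewrite !EcE /type_sum !(typed34 JJ _ _ _ _ (Ec_typed _ _ _)) /F /=.
by rewrite !expr0 !expr1; lra.
Qed.

(** J-invariance of [RD] in the first two arguments excludes components where these have the same
    type, and [Rc02] removes the Chern part when the fourth argument has that type as well. *)
Let EJ12 a b c d : Ec true false true a b c d = 0.
Proof.
have EN x y z w : E (- x) y z w = - E x y z w.
  rewrite !EcE /type_sum.
  have N y' z' w' : Ec y' z' w' (- x) y z w = - Ec y' z' w' x y z w.
    by have [] := Ec_typed y' z' w' x y z w.
  by rewrite !N; ring.
have h1 : RD (J a) b c (J d) + RD a (J b) c (J d) = 0.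
  by have := RDJ12 (J a) b c (J d); rewrite JJ => <-; rewrite !RDE RcN EN; ring.
have h2 := RDJ12 a b c d; have h3 := Rc02 a b c d.
have : E a b c d - E (J a) (J b) c d - E (J a) b c (J d) - E a (J b) c (J d) = 0.
  by move: h1 h2 h3; rewrite !RDE; lra.
have h y z w := Ec_typed y z w a b c d.
rewrite !EcE /type_sum !(typed24 JJ _ _ _ _ (Ec_typed _ _ _)).
have [-> _ -> _] := h true true true; have [-> _ -> _] := h true true false.
have [-> _ -> _] := h true false true; have [-> _ -> _] := h true false false.
have [-> _ -> _] := h false true true; have [-> _ -> _] := h false true false.
have [-> _ -> _] := h false false true; have [-> _ -> _] := h false false false.
by rewrite /= !expr0 !expr1; lra.
Qed.

(* Components by type of the cyclic sum of [RD]. *)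
Let Bc (by_ bz bw : bool) x y z w : R :=
  Ec by_ bz bw x y z w
  + Ec (by_ == bz) by_ (bw == by_) y z x w
  + Ec bz (by_ == bz) (bw == bz) z x y w
  + match by_, bz, bw with
    | true, true, false => d1 x y z w + d1 y z x w + d1 z x y w
        - q z x y w - q x y z w - q y z x w
    | false, false, true => d2 x y z w
    | false, true, false => d2 y z x w
    | true, false, false => d2 z x y w
    | _, _, _ => 0
    end.

(** The Bianchi identity for [RD], with the Chern torsion terms included, split by type. In the
    rotated summands the bits are recomputed relative to the new first argument. *)
Let Bc0 y z w a b c d : Bc y z w a b c d = 0.
Proof.
move: y z w a b c d; apply: (separate JJ) => [y z w|a b c d].
  case: y; case: z; case: w => a b c d; rewrite /Bc /= ?expr0 ?expr1;
    split; rewrite ?(TTJ, SSJ, qJ, d1J, d2J); ring.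
have := RD_bianchi a b c d.
have -> : RD a b c d + RD b c a d + RD c a b d =
  (Rc a b c d + Rc b c a d + Rc c a b d) + (E a b c d + E b c a d + E c a b d).
  by rewrite !RDE; ring.
rewrite Rc_bianchi (TC (T a b)) (TC (T b c)) (TC (T c a)) !gNl.
rewrite -!/(d0 _ _ _ _) -!/(q _ _ _ _) !d0E !EcE /type_sum /Bc => h.
by rewrite -[RHS]h /=; ring.
Qed.

Hypothesis s0 : s != 0.

Let d2C v x y w : d2 v y x w = - d2 v x y w.
Proof. by rewrite /d2 /d0 (DTC v y) (DTC (J v) y) !gNl; lra. Qed.

Let hI x y z w : 2 * (d2 x z w y - d2 y z w x + TT z w x y)
  + t * (SS x z w y + SS z x y w - SS y z w x - SS z y x w) = 0.
Proof.
have := @EJ34 true false false x y z w isT => /= h.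
by apply: (mulfI s0); rewrite mulr0; lra.
Qed.

(** Dividing a vanishing component of [E] by [s] expresses the J-linear part of the derivative of T
    quadratically in T. *)
Let hII x y z w : 2 * d1 x z w y = t * (q w x z y - q z x w y).
Proof.
have := @EJ34 false true true x y z w isT => /= h.
by apply: (mulfI s0); lra.
Qed.

(** In this component of the Bianchi identity one summand vanishes by [EJ34], and [t] times [hI]
    eliminates two of the derivatives, leaving t - 1 times a single one. *)
Let hIII x y z w : 4 * (t - 1) * d2 y x z w + 2 * t * (t - 1) * TT x z y w =
  (s ^+ 2 - t ^+ 2) * (SS z y w x - SS x y w z).
Proof.
have TTN a b c d : TT b a c d = - TT a b c d by rewrite /TT TC gNl.
have := Bc0 false true false x y z w; have := @EJ34 true false false z x y w isT.
rewrite /Bc /= => ->; have := hI x z y w.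
rewrite (d2C y x z) (TTN x z) (_ : TT y w x z = TT x z y w); last exact: gC.
move=> h1 h2.
rewrite (_ : 4 * (t - 1) * d2 y x z w = - (4 * d2 y x z w) + 4 * t * d2 y x z w);
  last by ring.
have := congr1 ( *%R t) h1; rewrite mulr0; move: h2; lra.
Qed.

(** [hI] multiplied by t - 1, with its two derivatives replaced through [hIII]. *)
Let quadr x y z w : 4 * (t - 1) ^+ 2 * TT x y z w =
  (s ^+ 2 + 2 * t - 3 * t ^+ 2) * quad g e T x y z w.
Proof.
have TTN : TT x y w z = - TT x y z w by rewrite /TT (TC w) gNr.
have := hIII x w y z; rewrite TTN; have := hIII x z y w.
have := congr1 ( *%R (t - 1)) (hI z w x y); rewrite mulr0.
rewrite /quad -!/(SS _ _ _ _) (SSC z x y w) (SSC w x y z); lra.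
Qed.

(** For t = 0, [hII] kills [d1], and the (true, true, false) part of the Bianchi identity retains
    only the terms T(T(.,.),.). *)
Lemma kahler_like_jacobi : t = 0 ->
  forall x y z, T (T x y) z + T (T y z) x + T (T z x) y = 0.
Proof.
move=> t0 x y z; apply: (g_inj gB gC eP) => w; rewrite !gDl (bil0l gB).
have D0 a b c d : d1 a b c d = 0.
  by have := hII a d b c; rewrite t0 mul0r; lra.
have := Bc0 true true false x y z w; rewrite /Bc /= t0 !D0.
rewrite (TC (T x y)) (TC (T y z)) (TC (T z x)) !gNl /q; lra.
Qed.

Lemma kahler_like_torsion0 : t != 0 -> ~ (t = 1 /\ s ^+ 2 = 1) ->
  forall x y, T x y = 0.
Proof.
move=> t0 ts; have [t1|t1] := eqVneq t 1.
  (* At t = 1 the left side of [hIII] is zero; dividing by s^2 - 1 leaves the required symmetry. *)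
  apply: (adj_sym_eq0 gB gC eP TB TC) => x y z w.
  have s1 : s ^+ 2 - 1 != 0 by rewrite subr_eq0; apply/eqP => s1; apply: ts.
  have := hIII y w x z; rewrite t1 expr1n subrr !(mulr0, mul0r) addr0 => /esym /eqP.
  rewrite mulf_eq0 (negPf s1) /= subr_eq0 => /eqP h.
  by rewrite -!/(SS _ _ _ _) h SSC.
have t1' : t - 1 != 0 by rewrite subr_eq0.
apply: (nilpotent_eq0 (k := (s ^+ 2 + 2 * t - 3 * t ^+ 2) / (4 * (t - 1) ^+ 2)) gB gC eP TB).
  move=> x y z w; rewrite mulrAC -quadr mulrAC divff ?mul1r//.
  by rewrite mulf_neq0 ?expf_neq0// pnatr_eq0.
(* Eliminating [d1] from [EJ12] by means of [hII] leaves t (t - 1) times T(T(x,y),z). *)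
move=> x y z; apply: (g_inj gB gC eP) => w; rewrite (bil0l gB) TC gNl -/(q z x y w).
apply: (mulfI t1'); apply: (mulfI t0); rewrite !(mulr0, mulrN).
have := EJ12 x y w z; have := congr1 ( *%R t) (hII x w y z).
have := congr1 ( *%R t) (hII y w x z); rewrite /Ec.
have -> : q z y x w = - q z x y w by rewrite /q (TC y) TNr gNl.
lra.
Qed.

Lemma kahler_like_torsion0_t0 : t = 0 -> s ^+ 2 != 4 ->
  (forall v x y z,
    DT v (T x y) z + T (DT v x y) z + (DT v (T y z) x + T (DT v y z) x) +
    (DT v (T z x) y + T (DT v z x) y) = 0) ->
  forall x y, T x y = 0.
Proof.
move=> t0 s2 dj.
have hQ x y z w : g (T x y) (T z w) = s ^+ 2 / 4 * quad g e T x y z w.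
  by have := quadr x y z w; rewrite t0 /TT; lra.
apply: (nilpotent_eq0 gB gC eP TB hQ).
apply: (jacobi_nilpotent gB gC eP TB TC (kahler_like_jacobi t0) DTB DTC dj _ _ hQ).
- by rewrite mulf_neq0 ?expf_neq0// invr_eq0 pnatr_eq0.
- apply: contra s2 => /eqP h; apply/eqP; lra.
(* At t = 0 only [d2] survives, and [hIII] gives it with the same constant s^2 / 4 as in [hQ]. *)
move=> v x y z; rewrite -/(d0 v x y z) d0E.
have -> : d1 v x y z = 0 by have := hII v z x y; rewrite t0 mul0r; lra.
have := hIII x v y z; rewrite t0 /quad -!/(SS _ _ _ _); lra.
Qed.

End KahlerLike.

(** * Covariant derivatives in a chart *)

Section Derive.
Variables (R : realType) (m : nat).
Local Notation V := 'rV[R]_m.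

(** A product rule for a family of linear forms known to be derivable only at each fixed vector;
    expanding in the standard basis reduces it to products of scalar functions. *)
Lemma is_derive_family_scalar (L : V -> V -> R^o) (f : V -> V) x v :
  (forall y, linear (L y)) -> (forall u, derivable (L^~ u) x v) ->
  derivable f x v ->
  is_derive x v (fun y => L y (f y)) ('D_v (L^~ (f x)) x + L x ('D_v f x)).
Proof.
move=> LL dL df.
have LE y u : L y u = \sum_j u ord0 j * L y (delta_mx ord0 j).
  pose h : {linear V -> R^o} := HB.pack (L y) (GRing.isLinear.Build R V R^o _ (L y) (LL y)).
  have -> : L y = h by [].
  rewrite {1}[u]row_sum_delta linear_sum.
  by apply: eq_bigr => j _; rewrite linearZ.
have dfj j : derivable (fun y => f y ord0 j : R^o) x v.
  by move/derivable_mxP : df; exact.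
have -> : (fun y => L y (f y)) =
    \sum_j ((fun y => f y ord0 j : R^o) * (L^~ (delta_mx ord0 j))).
  by apply/funext => y; rewrite LE fct_sumE.
have dLE u : 'D_v (L^~ u) x = \sum_j u ord0 j * 'D_v (L^~ (delta_mx ord0 j)) x.
  have -> : L^~ u = \sum_j (u ord0 j *: (L^~ (delta_mx ord0 j))).
    by apply/funext => y; rewrite LE fct_sumE.
  rewrite derive_sum => [|j]; last exact/derivableZ/dL.
  by apply: eq_bigr => j _; rewrite deriveZ.
apply: is_derive_eq.
  by apply: is_derive_sum => j; apply: is_deriveM; apply: derivableP; [exact: dfj|exact: dL].
rewrite big_split/= dLE; congr (_ + _).
rewrite LE; apply: eq_bigr => j _; rewrite derive_mx// mxE.
by rewrite mulrC.
Qed.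

Lemma is_derive_family (L : V -> V -> V) (f : V -> V) x v :
  (forall y, linear (L y)) -> (forall u, derivable (L^~ u) x v) ->
  derivable f x v ->
  is_derive x v (fun y => L y (f y)) ('D_v (L^~ (f x)) x + L x ('D_v f x)).
Proof.
move=> LL dL df.
pose Lc (j : 'I_m) y u : R^o := L y u ord0 j.
have h j : is_derive x v (fun y => L y (f y) ord0 j : R^o)
    ('D_v ((Lc j)^~ (f x)) x + Lc j x ('D_v f x)).
  apply: (is_derive_family_scalar (L := Lc j)) => //.
    by move=> y a u w; rewrite /Lc LL !mxE.
  by move=> u; move/derivable_mxP : (dL u); exact.
have d : derivable (fun y => L y (f y)) x v.
  by apply/derivable_mxP => i j; rewrite ord1; have [] := h j.
apply: DeriveDef => //.
rewrite derive_mx//; apply/rowP => j; rewrite !mxE.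
rewrite (derive_mx (dL _)) !mxE.
by have [_ ->] := h j.
Qed.

End Derive.

(* [ring] compares atoms up to conversion, which unfolds derivatives: the atoms
   are turned into variables first. *)
Ltac abstract_atom e :=
  lazymatch e with
  | (?a + ?b)%R => first [abstract_atom a | abstract_atom b]
  | (- ?a)%R => abstract_atom a
  | (_ *: ?a)%R => abstract_atom a
  | 0%R => fail
  | _ => tryif is_var e then fail else (let h := fresh in set h := e; clearbody h)
  end.
Ltac row_ring :=
  repeat match goal with
  | |- ?a = ?b => first [abstract_atom a | abstract_atom b]
  end; apply/rowP => ?; rewrite !mxE; ring.

(** * From Christoffel symbols on an open set to the pointwise identities *)

Section Local.
Variables (R : realType) (m : nat).
Local Notation V := 'rV[R]_m.
Variables (J : V -> V).
Hypothesis JL : linear J.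
Hypothesis JJ : forall u, J (J u) = - u.
Variables (U : set V) (M : V -> V -> V -> R^o) (Gc GD : V -> V -> V -> V).
Hypothesis Uo : open U.
Hypothesis MB : forall x, bilin (M x).
Hypothesis MC : forall x, U x -> forall u v, M x u v = M x v u.
Hypothesis Mpos : forall x, U x -> forall u, u != 0 -> 0 < M x u u.
Hypothesis MJ : forall x, U x -> forall u v, M x (J u) (J v) = M x u v.
Hypothesis Md : forall x, U x -> forall u v, differentiable (fun y => M y u v) x.
Hypothesis GcB : forall x, bilin (Gc x).
Hypothesis GDB : forall x, bilin (GD x).
Hypothesis Gcd : forall x, U x -> forall u v, differentiable (fun y => Gc y u v) x.
Hypothesis GDd : forall x, U x -> forall u v, differentiable (fun y => GD y u v) x.
Hypothesis Mc : forall x, U x -> forall u v w,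
  'D_u (fun y => M y v w) x = M x (Gc x u v) w + M x v (Gc x u w).
Hypothesis GcJ : forall x, U x -> forall u v, Gc x u (J v) = J (Gc x u v).
Let T x u v := Gc x u v - Gc x v u.
Let A x u v := GD x u v - Gc x u v.
Hypothesis T11 : forall x, U x -> forall u v,
  T x u v + T x (J u) (J v) = 0 /\ T x u (J v) = T x (J u) v.
Variables t s : R.
Hypothesis AE : forall x, U x -> forall u w z, M x (A x u w) z =
  (- t * M x (T x u w) z + t * M x (T x u z) w + s * M x (T x w z) u) / 2.

(** Curvature evaluated on constant fields, whose brackets vanish. *)
Definition local_curv (G : V -> V -> V -> V) x u v w :=
  'D_u (fun y => G y v w) x - 'D_v (fun y => G y u w) x
  + G x u (G x v w) - G x v (G x u w).

Let RD x u v w z := M x (local_curv GD x u v w) z.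
Hypothesis RD_bianchi : forall x, U x -> forall u v w z,
  RD x u v w z + RD x v w u z + RD x w u v z = 0.
Hypothesis RDJ12 : forall x, U x -> forall u v w z,
  RD x (J u) (J v) w z = RD x u v w z.
Hypothesis RDJ34 : forall x, U x -> forall u v w z,
  RD x u v (J w) (J z) = RD x u v w z.

Let nearU (P : V -> Prop) : (forall y, U y -> P y) -> forall x, U x -> \near x, P x.
Proof.
by move=> h x Ux; near=> y; apply: h; near: y; exact: open_nbhs_nbhs.
Unshelve. all: by end_near. Qed.

Let J0 : J 0 = 0.
Proof. by have := JL (-1) 0 0; rewrite scaler0 addr0 scaleN1r addNr. Qed.
Let JN u : J (- u) = - J u.
Proof. by have := JL (-1) u 0; rewrite !scaleN1r J0 !addr0. Qed.
Let JD u v : J (u + v) = J u + J v.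
Proof. by have := JL 1 u v; rewrite !scale1r. Qed.

Let derive_J (f : V -> V) x v : derivable f x v ->
  'D_v (fun y => J (f y)) x = J ('D_v f x).
Proof.
move=> df; have [_ ->] := @is_derive_family R m (fun=> J) f x v (fun=> JL)
  (fun u => derivable_cst (J u) x v) df.
by rewrite derive_cst add0r.
Qed.

(** [J] applied to the first condition of [T11], added to the second, isolates the claim: in
    holomorphic coordinates the Chern symbols are J-linear in both arguments. *)
Lemma christoffel_Jl x u v : U x -> Gc x (J u) v = J (Gc x u v).
Proof.
move=> Ux; have [p q] := T11 Ux u v; move: p q; rewrite /T !GcJ// => p q.
apply/rowP => j; have := congr1 (fun a : V => a ord0 j) (congr1 J p).
have := congr1 (fun a : V => a ord0 j) q.
by rewrite J0 !(JD, JN) !JJ !mxE; lra.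
Qed.

Let TB x : bilin (T x).
Proof.
have [h1 h2] := GcB x.
by split=> [u|v] a y z; rewrite /T h1 h2; row_ring.
Qed.
Let TC x u v : T x u v = - T x v u. Proof. by rewrite /T opprB. Qed.
Let TJl x u v : U x -> T x (J u) v = J (T x u v).
Proof. by move=> Ux; rewrite /T christoffel_Jl// GcJ// JD JN. Qed.

Let Td x u v : U x -> differentiable (fun y => T y u v) x.
Proof. by move=> Ux; apply: differentiableB; exact: Gcd. Qed.
Let Ad x u v : U x -> differentiable (fun y => A y u v) x.
Proof. by move=> Ux; apply: differentiableB; [exact: GDd|exact: Gcd]. Qed.

Definition cov_tensor (B : V -> V -> V -> V) x v u w :=
  'D_v (fun y => B y u w) x + Gc x v (B x u w) - B x (Gc x v u) w - B x u (Gc x v w).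

Section CovTensor.
Variable B : V -> V -> V -> V.
Hypothesis BB : forall x, bilin (B x).
Hypothesis Bd : forall x u v, U x -> differentiable (fun y => B y u v) x.

Lemma derive_bilin x v : U x -> bilin (fun u w => 'D_v (fun y => B y u w) x).
Proof.
move=> Ux; split=> [u|w] a y z.
  have -> : (fun y0 => B y0 u (a *: y + z)) =
    a *: (fun y0 => B y0 u y) + (fun y0 => B y0 u z).
    by apply/funext => y0; rewrite (BB y0).1.
  by rewrite deriveD ?deriveZ//; [|apply: derivableZ|]; exact/diff_derivable/Bd.
have -> : (fun y0 => B y0 (a *: y + z) w) =
    a *: (fun y0 => B y0 y w) + (fun y0 => B y0 z w).
  by apply/funext => y0; rewrite (BB y0).2.
by rewrite deriveD ?deriveZ//; [|apply: derivableZ|]; exact/diff_derivable/Bd.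
Qed.

Lemma cov_tensor_bilin x v : U x -> bilin (cov_tensor B x v).
Proof.
move=> Ux; have dB := derive_bilin v Ux.
have d1 u a y z : 'D_v (fun y0 => B y0 u (a *: y + z)) x =
  a *: 'D_v (fun y0 => B y0 u y) x + 'D_v (fun y0 => B y0 u z) x := dB.1 u a y z.
have d2 w a y z : 'D_v (fun y0 => B y0 (a *: y + z) w) x =
  a *: 'D_v (fun y0 => B y0 y w) x + 'D_v (fun y0 => B y0 z w) x := dB.2 w a y z.
have [h1 h2] := BB x; have [h3 h4] := GcB x.
by split=> [u|w] a y z; rewrite /cov_tensor ?(d1, d2) !(h3, h1, h2) ?(h3, h1, h2);
  row_ring.
Qed.

Lemma cov_tensorN x v u w : U x -> cov_tensor B x (- v) u w = - cov_tensor B x v u w.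
Proof.
move=> Ux; rewrite /cov_tensor !deriveE; do 2 ?exact: Bd.
rewrite linearN !(bilNl (GcB x)) (bilNl (BB x)) (bilNr (BB x)).
by row_ring.
Qed.

Lemma derive_metric x v u w z : U x ->
  is_derive x v (fun y => M y (B y u w) z)
    (M x (cov_tensor B x v u w) z + M x (B x (Gc x v u) w) z
     + M x (B x u (Gc x v w)) z + M x (B x u w) (Gc x v z)).
Proof.
move=> Ux; apply: is_derive_eq.
  apply: (is_derive_family_scalar (L := fun y b => M y b z)).
  - by move=> y; exact: (MB y).2.
  - by move=> b; exact/diff_derivable/Md.
  - exact/diff_derivable/Bd.
rewrite Mc// /cov_tensor !(bilDl (MB x)) !(bilNl (MB x)).
lra.
Qed.

(** The Jacobi identity holds throughout [U], so it can be differentiated. The Christoffel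
    corrections cancel by Jacobi with one argument replaced by its image under [Gc x v], and by
    [Gc x v] applied to Jacobi. *)
Lemma cov_tensor_jacobi :
  (forall x, U x -> forall a b c,
    B x (B x a b) c + B x (B x b c) a + B x (B x c a) b = 0) ->
  forall x, U x -> forall v a b c,
    cov_tensor B x v (B x a b) c + B x (cov_tensor B x v a b) c
    + (cov_tensor B x v (B x b c) a + B x (cov_tensor B x v b c) a)
    + (cov_tensor B x v (B x c a) b + B x (cov_tensor B x v c a) b) = 0.
Proof.
move=> jac x Ux v a b c.
have d a' b' c' : is_derive x v (fun y => B y (B y a' b') c')
    ('D_v (fun y => B y (B x a' b') c') x + B x ('D_v (fun y => B y a' b') x) c').
  apply: (is_derive_family (L := fun y u => B y u c')).
  - by move=> y; exact: (BB y).2.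
  - by move=> u; exact/diff_derivable/Bd.
  - exact/diff_derivable/Bd.
have [_ h] := is_deriveD (is_deriveD (d a b c) (d b c a)) (d c a b).
have E := etrans (esym h) (etrans (near_eq_derive (g := cst 0) v
  (nearU (fun y Uy => jac y Uy a b c) Ux)) (derive_cst 0 x v)).
have j1 := jac x Ux (Gc x v a) b c; have j2 := jac x Ux a (Gc x v b) c.
have j3 := jac x Ux a b (Gc x v c).
have j4 := congr1 (Gc x v) (jac x Ux a b c).
rewrite /cov_tensor !(bilDl (BB x)) !(bilNl (BB x)).
move: j4 E j1 j2 j3; rewrite (bil0r (GcB x)) !(bilDr (GcB x)) /=.
repeat match goal with
  | |- context [derive ?f x v] => let h := fresh in set h := derive f x v; clearbody h
  end.
repeat match goal with
  | |- context [B x ?p ?q] => let h := fresh in set h := B x p q; clearbody h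
  | |- context [Gc x ?p ?q] => let h := fresh in set h := Gc x p q; clearbody h
  end.
move=> j4 E j1 j2 j3; apply/rowP => i.
move: (congr1 (fun u : V => u ord0 i) E) (congr1 (fun u : V => u ord0 i) j1).
move: (congr1 (fun u : V => u ord0 i) j2) (congr1 (fun u : V => u ord0 i) j3).
move: (congr1 (fun u : V => u ord0 i) j4); rewrite !mxE.
lra.
Qed.

End CovTensor.

Let DT := cov_tensor T.
Let DA := cov_tensor A.

(** [AE] is differentiated along v; metric compatibility produces covariant derivatives, and [AE] at
    the corrected arguments removes the leftover Christoffel terms. *)
Let DAE x v u w z : U x -> M x (DA x v u w) z =
  (- t * M x (DT x v u w) z + t * M x (DT x v u z) w + s * M x (DT x v w z) u) / 2.
Proof.
move=> Ux; have dA := derive_metric Ad v u w z Ux.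
have d1 := derive_metric Td v u w z Ux.
have d2 := derive_metric Td v u z w Ux.
have d3 := derive_metric Td v w z u Ux.
have E : 'D_v (fun y => M y (A y u w) z) x =
    'D_v (2^-1 *: (- t *: (fun y => M y (T y u w) z) + t *: (fun y => M y (T y u z) w)
     + s *: (fun y => M y (T y w z) u))) x.
  apply: near_eq_derive; apply: nearU Ux => y Uy.
  by rewrite AE// mulrC.
move: E; rewrite deriveZ; last first.
  by apply: derivableD; [apply: derivableD|]; apply: derivableZ; apply: ex_derive.
rewrite deriveD; [|by apply: derivableD; apply: derivableZ; apply: ex_derive|
  by apply: derivableZ; apply: ex_derive].
rewrite deriveD; [|by apply: derivableZ; apply: ex_derive|
  by apply: derivableZ; apply: ex_derive].
rewrite !deriveZ; [|by apply: ex_derive..].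
rewrite !derive_val.
have := AE Ux (Gc x v u) w z; have := AE Ux u (Gc x v w) z.
have := AE Ux u w (Gc x v z).
rewrite -/DA -/DT /GRing.scale /= => -> -> ->; lra.
Qed.

Let DTC x v u w : U x -> DT x v u w = - DT x v w u.
Proof.
move=> Ux; rewrite /DT /cov_tensor.
have -> : (fun y => T y u w) = - (fun y => T y w u).
  by apply/funext => y; rewrite TC.
rewrite deriveN; last exact/diff_derivable/Td.
rewrite (TC x w u) (TC x (Gc x v w) u) (TC x w (Gc x v u)) (bilNr (GcB x)).
by row_ring.
Qed.

Let DTJl x v u w : U x -> DT x v (J u) w = J (DT x v u w).
Proof.
move=> Ux; rewrite /DT /cov_tensor.
have -> : 'D_v (fun y => T y (J u) w) x = 'D_v (fun y => J (T y u w)) x.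
  by apply: near_eq_derive; apply: nearU Ux => y Uy; rewrite TJl.
rewrite derive_J; last exact/diff_derivable/Td.
by rewrite !GcJ// !TJl// GcJ// !(JD, JN).
Qed.

Let Rc x u v w z := M x (local_curv Gc x u v w) z.

Let derive_opp f x v : differentiable (f : V -> V) x -> 'D_(- v) f x = - 'D_v f x.
Proof. by move=> df; rewrite !deriveE// linearN. Qed.

Let RcN x u v w z : U x -> Rc x (- u) v w z = - Rc x u v w z.
Proof.
move=> Ux; rewrite /Rc /local_curv -(bilNl (MB x)); congr (M x _ z).
rewrite derive_opp; last exact: Gcd.
have -> : (fun y => Gc y (- u) w) = - (fun y => Gc y u w).
  by apply/funext => y; rewrite (bilNl (GcB y)).
rewrite deriveN; last exact/diff_derivable/Gcd.
rewrite !(bilNl (GcB x)) (bilNr (GcB x)).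
by row_ring.
Qed.

Let local_curvJ x u v w : U x -> local_curv Gc x u v (J w) = J (local_curv Gc x u v w).
Proof.
move=> Ux; rewrite /local_curv.
have dJ a b : 'D_a (fun y => Gc y b (J w)) x = J ('D_a (fun y => Gc y b w) x).
  rewrite -derive_J; last exact/diff_derivable/Gcd.
  by apply: near_eq_derive; apply: nearU Ux => y Uy; rewrite GcJ.
by rewrite !dJ !GcJ// !(JD, JN).
Qed.

Let RcJ x u v w z : U x -> Rc x u v (J w) (J z) = Rc x u v w z.
Proof. by move=> Ux; rewrite /Rc local_curvJ// MJ. Qed.

Let Rc_bianchi x u v w z : U x ->
  Rc x u v w z + Rc x v w u z + Rc x w u v z =
  M x (DT x u v w) z + M x (DT x v w u) z + M x (DT x w u v) z
  + (M x (T x (T x u v) w) z + M x (T x (T x v w) u) z + M x (T x (T x w u) v) z).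
Proof.
move=> Ux; rewrite /Rc -!(bilDl (MB x)); congr (M x _ z).
have dT a b c : 'D_a (fun y => T y b c) x =
    'D_a (fun y => Gc y b c) x - 'D_a (fun y => Gc y c b) x.
  by rewrite -deriveB//; exact/diff_derivable/Gcd.
rewrite /DT /cov_tensor !dT /local_curv /T.
rewrite !(bilDr (GcB x)) !(bilDl (GcB x)) !(bilNr (GcB x)) !(bilNl (GcB x)).
by row_ring.
Qed.

(** The Chern connection form has type (1,0) in a holomorphic frame. By J-linearity of the symbols
    the derivative terms cancel in pairs, and so do the commutators. *)
Let Rc02 x u v w z : U x -> Rc x u v w z - Rc x (J u) (J v) w z
  - Rc x (J u) v w (J z) - Rc x u (J v) w (J z) = 0.
Proof.
move=> Ux.
have MJr a b : M x a (J b) = - M x (J a) b.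
  by rewrite -(MJ Ux a) JJ (bilNr (MB x)).
rewrite /Rc !MJr !opprK -!(bilNl (MB x)) -!(bilDl (MB x)) -[RHS](bil0l (MB x) z).
congr (M x _ z); rewrite /local_curv.
have dJ a b c : 'D_a (fun y => Gc y (J b) c) x = J ('D_a (fun y => Gc y b c) x).
  rewrite -derive_J; last exact/diff_derivable/Gcd.
  by apply: near_eq_derive; apply: nearU Ux => y Uy; rewrite christoffel_Jl.
rewrite !dJ !christoffel_Jl// !GcJ// ?christoffel_Jl// !(JD, JN) !JJ.
by row_ring.
Qed.

Let RDE x u v w z : U x ->
  RD x u v w z = Rc x u v w z + curv_diff (M x) (T x) (A x) (DA x) u v w z.
Proof.
move=> Ux; rewrite /RD /Rc /curv_diff -!(bilNl (MB x)) -!(bilDl (MB x)).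
congr (M x _ z).
have dA a b c : 'D_a (fun y => A y b c) x =
    'D_a (fun y => GD y b c) x - 'D_a (fun y => Gc y b c) x.
  by rewrite -deriveB//; [exact/diff_derivable/GDd|exact/diff_derivable/Gcd].
rewrite /DA /cov_tensor !dA /local_curv /T /A.
rewrite !(bilDr (GcB x)) !(bilDl (GcB x)) !(bilNr (GcB x)) !(bilNl (GcB x)).
rewrite !(bilDr (GDB x)) !(bilDl (GDB x)) !(bilNr (GDB x)) !(bilNl (GDB x)).
by row_ring.
Qed.

Hypothesis s0 : s != 0.

(** Stated on all of [U], since its covariant derivative enters the case t = 0. *)
Let jacobi x : t = 0 -> U x -> forall u v w,
  T x (T x u v) w + T x (T x v w) u + T x (T x w u) v = 0.
Proof.
move=> t0 Ux; have [k [e eP]] := orthonormal_basis (MB x) (MC Ux) (Mpos Ux).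
apply: (kahler_like_jacobi (MB x) (MC Ux) JL JJ (MJ Ux) eP (TB x) (TC x)
  (fun u v => TJl u v Ux) (fun v => cov_tensor_bilin TB Td v Ux)
  (fun v u w => cov_tensorN TB Td v u w Ux) (fun v u w => DTC v u w Ux)
  (fun v u w => DTJl v u w Ux) (AE Ux) (fun v u w z => DAE v u w z Ux)
  (fun u v w z => RcJ u v w z Ux) (fun u v w z => Rc_bianchi u v w z Ux)
  (fun u v w z => RDE u v w z Ux) (RD_bianchi Ux) (RDJ34 Ux) s0 t0).
Qed.

Lemma local_torsion0 : ~ (t = 1 /\ s ^+ 2 = 1) -> ~ (t = 0 /\ s ^+ 2 = 4) ->
  forall x, U x -> forall u v, Gc x u v = Gc x v u.
Proof.
move=> ts1 ts0 x Ux u v; apply/eqP; rewrite -subr_eq0; apply/eqP; rewrite -/(T x u v).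
have [k [e eP]] := orthonormal_basis (MB x) (MC Ux) (Mpos Ux).
have [t0|t0] := eqVneq t 0.
  apply: (kahler_like_torsion0_t0 (MB x) (MC Ux) JL JJ (MJ Ux) eP (TB x) (TC x)
    (fun u v => TJl u v Ux) (fun v => cov_tensor_bilin TB Td v Ux)
    (fun v u w => cov_tensorN TB Td v u w Ux) (fun v u w => DTC v u w Ux)
    (fun v u w => DTJl v u w Ux) (AE Ux) (fun v u w z => DAE v u w z Ux)
    (fun u v w z => RcJ u v w z Ux) (fun u v w z => Rc_bianchi u v w z Ux)
    (fun u v w z => RDE u v w z Ux) (RD_bianchi Ux) (RDJ34 Ux) s0 t0 _
    (cov_tensor_jacobi TB Td (fun y Uy => jacobi t0 Uy) Ux)).
  by apply/eqP => s2; apply: ts0.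
exact: (kahler_like_torsion0 (MB x) (MC Ux) JL JJ (MJ Ux) eP (TB x) (TC x)
    (fun u v => TJl u v Ux) (fun v => cov_tensor_bilin TB Td v Ux)
    (fun v u w => cov_tensorN TB Td v u w Ux) (fun v u w => DTC v u w Ux)
    (fun v u w => DTJl v u w Ux) (AE Ux) (fun v u w z => DAE v u w z Ux)
    (fun u v w z => RcN u v w z Ux)
    (fun u v w z => RcJ u v w z Ux) (fun u v w z => Rc_bianchi u v w z Ux)
    (fun u v w z => Rc02 u v w z Ux)
    (fun u v w z => RDE u v w z Ux) (RD_bianchi Ux) (RDJ12 Ux) (RDJ34 Ux) s0 t0 ts1).
Qed.
End Local.

(** * Levi-Civita and Strominger connections in terms of the Chern torsion *)

Lemma bilinear_bilin (R : nzRingType) (U V W : lmodType R) (f : {bilinear U -> V -> W}) :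
  bilin f.
Proof. by split=> [u|v] a x y; [exact: linearPr|exact: linearPl]. Qed.

(** With B = Levi-Civita - Chern: a trilinear form skew in its last two arguments is determined by
    its skew part in the first two, through the usual permutation argument. *)
Lemma koszul (R : realFieldType) (V : lmodType R) (g : V -> V -> R) (T B : V -> V -> V) :
  bilin (g : V -> V -> R^o) ->
  (forall x y, T x y = - T y x) ->
  (forall x y z, g (B x y) z = - g (B x z) y) ->
  (forall x y, B x y - B y x = - T x y) ->
  forall x y z, g (B x y) z = (- g (T x y) z + g (T x z) y + g (T y z) x) / 2.
Proof.
move=> gB TC Bskew BT x y z.
have gN u w : g (- u) w = - g u w by exact: (bilNl gB).
have h u v w : g (B u v) w - g (B v u) w = - g (T u v) w.
  by rewrite -[RHS]gN -BT; apply/esym; exact: (bilBl gB).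
have := h x y z; have := h y z x; have := h x z y.
have := Bskew x y z; have := Bskew y x z; have := Bskew z x y.
lra.
Qed.

(** With B = Strominger - Chern. [H] is the Strominger torsion; the permutation argument expresses
    [B] through [H] and [T], and compatibility with [J] then determines [H]. *)
Lemma strominger_formula (R : realFieldType) (V : lmodType R) (g : V -> V -> R)
    (J : V -> V) (T B : V -> V -> V) :
  bilin (g : V -> V -> R^o) -> bilin B ->
  (forall u, J (J u) = - u) ->
  (forall u v, g (J u) (J v) = g u v) ->
  (forall x y, T x y = - T y x) ->
  (forall x y, T (J x) y = J (T x y)) ->
  (forall x y, T x (J y) = J (T x y)) ->
  (forall x y z, g (B x y) z = - g (B x z) y) ->
  (forall x y, B x (J y) = J (B x y)) ->
  (forall x y z, g (T x z + B x z - B z x) y = - g (T x y + B x y - B y x) z) ->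
  forall x y z, g (B x y) z = - g (T x y) z + g (T x z) y.
Proof.
move=> gB BB JJ gJJ TC TJl TJr Bskew BJ Hskew.
have gN u w : g (- u) w = - g u w by exact: (bilNl gB).
have gNr u w : g u (- w) = - g u w by exact: (bilNr gB).
have gD u v w : g (u + v) w = g u w + g v w by exact: (bilDl gB).
have gJl u v : g (J u) v = - g u (J v) by rewrite -(gJJ u) JJ gNr opprK.
pose H x y z := g (T x y + B x y - B y x) z.
have HE x y z : H x y z = g (T x y) z + g (B x y) z - g (B y x) z.
  by rewrite /H !gD gN.
have H13 x y z : H x z y = - H x y z by exact: Hskew.
have H12 x y z : H y x z = - H x y z by rewrite !HE TC gN; lra.
have BE x y z : 2 * g (B x y) z =
    H x y z - g (T x y) z + g (T y z) x - g (T z x) y.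
  have := HE x y z; have := HE y z x; have := HE z x y.
  have := H13 x y z; have := H13 y x z; have := H12 x z y; have := H12 x y z.
  have := Bskew x y z; have := Bskew y x z; have := Bskew z x y; lra.
have BJJ x y z : g (B x (J y)) (J z) = g (B x y) z by rewrite BJ gJJ.
have TJJ x y z : g (T (J x) y) (J z) = g (T x y) z by rewrite TJl gJJ.
have TJJ' x y z : g (T x (J y)) (J z) = g (T x y) z by rewrite TJr gJJ.
have TJJ2 x y z : g (T (J x) (J y)) z = - g (T x y) z.
  by rewrite TJl TJr JJ gN.
(* Comparison of [BE] at (x, y, z) and (x, J y, J z), where the left-hand sides agree. *)
have h x y z : H x (J y) (J z) = H x y z + 2 * g (T y z) x.
  have := BE x y z; have := BE x (J y) (J z); rewrite BJJ TJJ' TJJ2 (TC (J z)).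
  by rewrite gN TJJ' (TC x z) gN; lra.
have h' x y z : H (J x) (J y) z + H (J x) y (J z) = - (2 * g (T y z) x).
  have := h (J x) (J y) z; rewrite JJ TJl gJJ.
  have -> : H (J x) (- y) (J z) = - H (J x) y (J z).
    rewrite !HE (bilNr BB) (bilNl BB) !gN.
    by rewrite -{1}(JJ y) !TJr JJ gN; ring.
  by lra.
(* Substituting two rotations of [h] into [h'] gives H(x,y,z) = - (<T(x,y),z> + <T(y,z),x> +
   <T(z,x),y>), which is inserted into [BE]. *)
move=> x y z; apply: (mulfI (x := 2)); first by rewrite pnatr_eq0.
rewrite BE; have := h' x y z; have := h y z x; have := h z x y.
have := H12 y (J z) (J x); have := H13 (J x) y (J z); have := H13 y (J z) (J x).
have := H12 z (J x) (J y); have := H13 (J x) z (J y); have := H13 z (J x) (J y).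
have := H12 x y z; have := H13 x y z; have := H12 x z y; have := H13 y x z.
have := H12 y z x; have := H13 z x y.
rewrite (TC x z) (TC z x) !gN.
have := H12 (J x) (J z) y.
have := H12 (J x) z (J y); have := H12 (J x) y (J z).
lra.
Qed.

(** * The canonical connections in a holomorphic chart *)

Lemma J_linear (R : realType) (n : nat) : linear (@J R n).
Proof.
move=> a u v; rewrite /J scale_row_mx add_row_mx; congr row_mx; last exact: linearP.
by rewrite linearP opprD scalerN.
Qed.

Lemma J_involutive (R : realType) (n : nat) (u : Cvec R n) : J (J u) = - u.
Proof.
by rewrite /J row_mxKl row_mxKr -{3}[u]hsubmxK opp_row_mx.
Qed.

Section Chart.
Variables (R : realType) (n : nat) (M : topologicalType) (A : complexManifold R n M).
Variable c : chart A.
Local Notation V := (Cvec R n).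

(** Constant fields are admissible test fields; on them covariant derivatives reduce to Christoffel
    symbols and brackets vanish. *)
Lemma smooth_on_cst (W : normedModType R) (U : set V) (w : W) : smooth_on U (cst w).
Proof.
move=> k; elim: k w => [|k IH] w /=; first by move=> x _; exact: cst_continuous.
split=> [x _|v]; first exact: differentiable_cst.
rewrite (_ : (fun x => _) = cst 0); first exact: IH.
by apply/funext => x; rewrite derive_cst.
Qed.

Lemma cov_cst (D : connection A) (u v x : V) :
  cov D c (cst u) (cst v) x = christoffel D c x u v.
Proof. by rewrite /cov derive_cst add0r. Qed.

Lemma torsion_cst (D : connection A) (u v x : V) :
  torsion (cov D) c (cst u) (cst v) x =
  christoffel D c x u v - christoffel D c x v u.
Proof. by rewrite /torsion !cov_cst /lie !derive_cst !subr0. Qed.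

Lemma metric_parallel_cst (g : hermitianMetric A) (D : connection A) :
  metric_parallel g (cov D) -> forall x, img c x -> forall u v w : V,
  'D_u (fun y => metric g c y v w : R^o) x =
  metric g c x (christoffel D c x u v) w + metric g c x v (christoffel D c x u w).
Proof.
move=> h x Ux u v w.
have := h c (cst u) (cst v) (cst w) (@smooth_on_cst _ _ _) (@smooth_on_cst _ _ _)
  (@smooth_on_cst _ _ _) x Ux.
by rewrite /inner !cov_cst.
Qed.

Lemma J_parallel_cst (D : connection A) : J_parallel (cov D) ->
  forall x, img c x -> forall u v : V,
  christoffel D c x u (J v) = J (christoffel D c x u v).
Proof.
move=> h x Ux u v.
have := h c (cst u) (cst v) (@smooth_on_cst _ _ _) (@smooth_on_cst _ _ _) x Ux.
by rewrite (_ : @J R n \o cst v = cst (J v))// !cov_cst.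
Qed.

Section Canonical.
Variables (g : hermitianMetric A) (nabla nablac nablas : connection A).
Hypothesis lc : is_levi_civita g nabla.
Hypothesis chern : is_chern g nablac.
Hypothesis strominger : is_strominger g nablas.
Variables r s : R.
Let t := 1 - r + r * s.
Local Notation D := (canonical_connection nabla nablac nablas r s).

Let G0 x u v := christoffel nabla c x u v.
Let Gc x u v := christoffel nablac c x u v.
Let Gs x u v := christoffel nablas c x u v.

Definition canonical_christoffel x u v :=
  (1 - s) *: (((1 + r) / 2) *: Gc x u v + ((1 - r) / 2) *: Gs x u v) + s *: G0 x u v.
Local Notation GD := canonical_christoffel.

Let T x u v := Gc x u v - Gc x v u.

(** The weights of the three connections add up to 1, so the derivative term appears once. *)
Lemma canonical_connectionE X Y x : D c X Y x = 'D_(X x) Y x + GD x (X x) (Y x).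
Proof.
rewrite /canonical_connection /gauduchon /cov /GD /Gc /Gs /G0.
by apply/rowP => j; rewrite !mxE; field.
Qed.

Let canonical_cst u v x : D c (cst u) (cst v) x = GD x u v.
Proof. by rewrite canonical_connectionE derive_cst add0r. Qed.

Let GcB x : bilin (Gc x). Proof. exact: bilinear_bilin. Qed.
Let GDB x : bilin (GD x).
Proof.
have [h1 h2] := GcB x; have [h3 h4] := bilinear_bilin (christoffel nablas c x).
have [h5 h6] := bilinear_bilin (christoffel nabla c x).
split=> [u|v] a y z; rewrite /canonical_christoffel /Gs /G0.
  by rewrite h1 h3 h5; row_ring.
by rewrite h2 h4 h6; row_ring.
Qed.
Let MB x : bilin (fun u v => metric g c x u v : R^o).
Proof. exact: bilinear_bilin. Qed.

Lemma curvature_cst u v w x :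
  curvature D c (cst u) (cst v) (cst w) x = local_curv GD x u v w.
Proof.
have e a b : D c (cst a) (cst b) = fun y => GD y a b by apply/funext => y; exact: canonical_cst.
have lie0 : lie (cst u) (cst v) = cst 0.
  by apply/funext => y; rewrite /lie !derive_cst subr0.
rewrite /curvature lie0 !e !canonical_connectionE (bil0l (GDB x)) subr0 /local_curv /=.
by rewrite opprD addrACA addrA.
Qed.

Let Gd (E : connection A) x u v : img c x ->
  differentiable (fun y => christoffel E c y u v) x.
Proof. by move=> Ux; exact: (christoffel_smooth E c u v 1).1. Qed.

Let GDd x : img c x -> forall u v, differentiable (fun y => GD y u v) x.
Proof.
move=> Ux u v; apply: differentiableD; last by apply: differentiableZ; exact: Gd.
apply: differentiableZ; apply: differentiableD; apply: differentiableZ; exact: Gd.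
Qed.

Let GcJ : forall x, img c x -> forall u v, Gc x u (J v) = J (Gc x u v).
Proof. by have [_ h _] := chern; exact: J_parallel_cst. Qed.

Let T11 x : img c x -> forall u v,
  T x u v + T x (J u) (J v) = 0 /\ T x u (J v) = T x (J u) v.
Proof.
move=> Ux u v; have [_ _ h] := chern.
have := h c (cst u) (cst v) (@smooth_on_cst _ _ _) (@smooth_on_cst _ _ _) x Ux.
have eJ a : @J R n \o cst a = cst (J a) by [].
by rewrite !eJ !torsion_cst => -[-> /eqP]; rewrite subr_eq0 => /eqP.
Qed.

Let TC x u v : T x u v = - T x v u. Proof. by rewrite /T opprB. Qed.

Let TJl x u v : img c x -> T x (J u) v = J (T x u v).
Proof.
move=> Ux; rewrite /T GcJ// (christoffel_Jl (@J_linear R n) (@J_involutive R n) GcJ T11)//.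
by have := @J_linear R n (-1) (Gc x v u) (Gc x u v); rewrite !scaleN1r addrC => <-; rewrite addrC.
Qed.

Let TJr x u v : img c x -> T x u (J v) = J (T x u v).
Proof. by move=> Ux; rewrite -TJl//; have [] := T11 Ux u v. Qed.

(** GD - Gc combines Strominger - Chern with weight (1 - s)(1 - r)/2 and Levi-Civita - Chern with
    weight s; the coefficient t arises as (1 - s)(1 - r) + s. *)
Let AE x : img c x -> forall u w z, metric g c x (GD x u w - Gc x u w) z =
  (- t * metric g c x (T x u w) z + t * metric g c x (T x u z) w
   + s * metric g c x (T x w z) u) / 2 :> R.
Proof.
move=> Ux u w z; have [mc _ _] := chern; have [m0 tf] := lc; have [ms Js sk] := strominger.
pose m a b : R := metric g c x a b.
have mC a b : m a b = m b a by exact: (Defs.metric_sym g Ux).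
have mB : bilin (m : _ -> _ -> R^o) by exact: MB.
have mBl a b d : m (a - b) d = m a d - m b d by exact: (bilBl mB).
have mDl a b d : m (a + b) d = m a d + m b d by exact: (bilDl mB).
have mNl a d : m (- a) d = - m a d by exact: (bilNl mB).
have mZl k a b : m (k *: a) b = k * m a b by exact: (bilZl mB).
have skew (E : connection A) : metric_parallel g (cov E) -> forall a b d,
    m (christoffel E c x a b - Gc x a b) d = - m (christoffel E c x a d - Gc x a d) b.
  move=> mE a b d; have := metric_parallel_cst mE Ux a b d.
  rewrite (metric_parallel_cst mc Ux a b d) -!/(m _ _) !(mC b) !mBl /Gc; lra.
have B0 a b d : m (G0 x a b - Gc x a b) d =
    (- m (T x a b) d + m (T x a d) b + m (T x b d) a) / 2.
  apply: (koszul (B := fun a b => G0 x a b - Gc x a b) mB (TC x)).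
    by move=> *; exact: skew.
  move=> {}a {}b; have := tf c (cst a) (cst b) (@smooth_on_cst _ _ _) (@smooth_on_cst _ _ _) x Ux.
  rewrite torsion_cst -!/(G0 _ _ _) => /eqP; rewrite subr_eq0 => /eqP ->.
  by rewrite /T; row_ring.
have Bs a b d : m (Gs x a b - Gc x a b) d = - m (T x a b) d + m (T x a d) b.
  apply: (strominger_formula (J := @J R n) (B := fun a b => Gs x a b - Gc x a b) mB).
  - have [h1 h2] := GcB x; have [h3 h4] := bilinear_bilin (christoffel nablas c x).
    by split=> [y|y] k p q; rewrite /Gs ?h1 ?h3 ?h2 ?h4; row_ring.
  - exact: J_involutive.
  - by move=> *; exact: (metric_J g).
  - exact: TC.
  - by move=> *; exact: TJl.
  - by move=> *; exact: TJr.
  - by move=> *; exact: skew.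
  - move=> p q; rewrite /Gs (J_parallel_cst Js Ux) GcJ//.
    have := @J_linear R n (-1) (Gc x p q) (Gs x p q).
    by rewrite !scaleN1r addrC => <-; rewrite addrC.
  move=> p q k.
  have e a' b' : T x a' b' + (Gs x a' b' - Gc x a' b') - (Gs x b' a' - Gc x b' a') =
      Gs x a' b' - Gs x b' a' by rewrite /T; row_ring.
  have := sk c (cst p) (cst q) (cst k) (@smooth_on_cst _ _ _) (@smooth_on_cst _ _ _)
    (@smooth_on_cst _ _ _) x Ux.
  by rewrite /inner !torsion_cst !e => -[_].
have -> : GD x u w - Gc x u w =
    ((1 - s) * (1 - r) / 2) *: (Gs x u w - Gc x u w) + s *: (G0 x u w - Gc x u w).
  by rewrite /canonical_christoffel; apply/rowP => j; rewrite !mxE; field.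
by rewrite -!/(m _ _) mDl !mZl B0 Bs /t; field.
Qed.

Hypothesis kl : kahler_like g D.

Let kl_cst x : img c x -> forall u v w z : V,
  let K a b d f := metric g c x (local_curv GD x a b d) f : R in
  [/\ K u v w z + K v w u z + K w u v z = 0, K (J u) (J v) w z = K u v w z
    & K u v (J w) (J z) = K u v w z].
Proof.
move=> Ux u v w z /=.
have := kl (c := c) (X := cst u) (Y := cst v) (Z := cst w) (W := cst z)
  (@smooth_on_cst _ _ _) (@smooth_on_cst _ _ _) (@smooth_on_cst _ _ _)
  (@smooth_on_cst _ _ _) Ux.
have eJ a : @J R n \o cst a = cst (J a) by [].
by rewrite !eJ /curvature4 /inner !curvature_cst.
Qed.

Lemma chern_symmetric : s != 0 -> ~ (t = 1 /\ s ^+ 2 = 1) -> ~ (t = 0 /\ s ^+ 2 = 4) ->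
  forall x, img c x -> forall u v, Gc x u v = Gc x v u.
Proof.
move=> s0 ts1 ts0.
apply: (@local_torsion0 R _ (@J R n) (@J_linear R n) (@J_involutive R n) (img c)
  (fun x u v => metric g c x u v : R^o) Gc GD _ MB _ _ _ _ GcB GDB _ GDd _ GcJ T11 t s AE
  _ _ _ s0 ts1 ts0).
- exact: img_open.
- exact: (Defs.metric_sym g).
- exact: (Defs.metric_pos g).
- exact: (metric_J g).
- by move=> x Ux u v; exact: (metric_smooth g c u v 1).1.
- by move=> x Ux u v; exact: Gd.
- by have [mc _ _] := chern; exact: metric_parallel_cst.
- by move=> x Ux u v w z; have [] := kl_cst Ux u v w z.
- by move=> x Ux u v w z; have [] := kl_cst Ux u v w z.
- by move=> x Ux u v w z; have [] := kl_cst Ux u v w z.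
Qed.

End Canonical.

(** Leibniz rule expressing that the Kaehler form is parallel, because the metric and [J] are. *)
Lemma derive_kahler_form (g : hermitianMetric A) (D : connection A) :
  metric_parallel g (cov D) -> J_parallel (cov D) ->
  forall Y Z x u, vfield c Y -> vfield c Z -> img c x ->
  let a W := 'D_u W x + christoffel D c x u (W x) in
  'D_u (kahler_form g c Y Z) x
  = metric g c x (J (a Y)) (Z x) + metric g c x (J (Y x)) (a Z).
Proof.
move=> mD JD Y Z x u Ys Zs Ux a.
have dM p q : derivable (fun y => metric g c y p q : R^o) x u.
  exact/diff_derivable/(metric_smooth g c p q 1).1.
have dY := diff_derivable (v := u) ((Ys 1).1 x Ux).
have dZ := diff_derivable (v := u) ((Zs 1).1 x Ux).
have JB := @J_linear R n.
have dZM p : is_derive x u (fun y => metric g c y (J p) (Z y) : R^o)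
    ('D_u (fun y => metric g c y (J p) (Z x) : R^o) x
     + metric g c x (J p) ('D_u Z x)).
  by apply: (is_derive_family_scalar (L := fun y => metric g c y (J p))) => // y;
    exact: (bilinear_bilin (metric g c y)).1.
have [_ ->] : is_derive x u (kahler_form g c Y Z)
    ('D_u (fun y => metric g c y (J (Y x)) (Z y) : R^o) x
     + metric g c x (J ('D_u Y x)) (Z x)).
  apply: (is_derive_family_scalar (L := fun y p => metric g c y (J p) (Z y))) => //.
    by move=> y k p q; rewrite JB linearPl.
have [_ e1] := dZM (Y x); rewrite e1.
rewrite (metric_parallel_cst mD Ux) (J_parallel_cst JD Ux) /a.
have := JB 1 ('D_u Y x) (christoffel D c x u (Y x)); rewrite !scale1r => ->.
rewrite linearDl linearDr; lra.
Qed.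

End Chart.

(** * The excluded parameters, and closedness of the Kaehler form *)

Theorem theorem4 (R : realType) (n : nat) (M : topologicalType)
    (A : complexManifold R n M) (g : hermitianMetric A)
    (nabla nablac nablas : connection A)
    (nabla_lc : is_levi_civita g nabla)
    (nablac_chern : is_chern g nablac)
    (nablas_strominger : is_strominger g nablas)
    (r s : R) (rs : Omega' (r, s))
    (kl : kahler_like g (canonical_connection nabla nablac nablas r s)) :
  is_kahler g.
Proof.
have [om1 om2] := rs.
have s0 : s != 0 by apply/eqP => s0; apply: om2; left.
have pts p : p \in [:: (0, 1); (0, -1); (-1, 2); (1 / 3, -2)] -> (r, s) <> p.
  by move=> h e; apply: om2; right; rewrite /= e.
(* For s = 1 the value t = 1 is automatic: r = 0 is an excluded point and r <> 0 lies outside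
   [Omega]. For s = -1, t = 1 forces r = 0. *)
have ts1 : ~ (1 - r + r * s = 1 /\ s ^+ 2 = 1).
  move=> [t1 /eqP]; rewrite sqrf_eq1 => /orP[] /eqP s1.
    have [r0|r0] := eqVneq r 0; last by apply: om1.
    by apply: (pts (0, 1)); rewrite ?inE ?eqxx// r0 s1.
  apply: (pts (0, -1)); rewrite ?inE ?eqxx ?orbT// s1; congr (_, _).
  by move: t1; rewrite s1; lra.
(* Here t = 0 reads 1 + r = 0 for s = 2 and 1 - 3 r = 0 for s = -2. *)
have ts0 : ~ (1 - r + r * s = 0 /\ s ^+ 2 = 4).
  move=> [t0 /eqP]; rewrite (_ : 4 = 2 ^+ 2); last by ring.
  rewrite eqf_sqr => /orP[] /eqP s2.
    apply: (pts (-1, 2)); rewrite ?inE ?eqxx ?orbT// s2; congr (_, _).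
    by move: t0; rewrite s2; lra.
  apply: (pts (1 / 3, -2)); rewrite ?inE ?eqxx ?orbT// s2; congr (_, _).
  by move: t0; rewrite s2; lra.
move=> c X Y Z Xs Ys Zs x Ux.
have sym := chern_symmetric nabla_lc nablac_chern nablas_strominger kl s0 ts1 ts0 Ux.
have [mc Jc _] := nablac_chern.
rewrite !(derive_kahler_form mc Jc _ _ _ Ux)//.
pose a U W := 'D_(U x) W x + christoffel nablac c x (U x) (W x).
(* Without torsion the brackets are differences of Chern derivatives, so the six terms of the
   exterior derivative of a parallel form cancel by skewness. *)
have lieE U W : lie U W x = a U W - a W U.
  by rewrite /lie /a sym opprD addrACA subrr addr0.
have Jsub (p q : Cvec R n) : J (p - q) = J p - J q.
  by have := @J_linear R n (-1) q p; rewrite !scaleN1r addrC => <-; rewrite addrC.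
have mJ (p q : Cvec R n) : metric g c x (J p) q = - metric g c x (J q) p.
  by rewrite -(metric_J g Ux (J p)) J_involutive linearNl (Defs.metric_sym g Ux).
rewrite /kahler_form /inner /= !lieE !Jsub !linearBl -!/(a _ _).
have := mJ (Y x) (a X Z); have := mJ (Z x) (a Y X); have := mJ (X x) (a Z Y).
lra.
Qed.
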